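(* Let $\sigma\ge1$ and $\mu\ge1/2$ be arbitrary, and consider a function $u:\mathbb{T}^m\times\mathbb{R}^n\to\mathbb{C}$ satisfying the following property: for every $\varepsilon>0$, there is $C_\varepsilon>0$ such that $$|u(t,\xi)|\leq C_\varepsilon e^{\varepsilon|\xi|^{1/\mu}}\quad\text{for all }(t,\xi)\in\mathbb{T}^m\times\mathbb{R}^n.$$ Then there exists $\check u\in\bigcap_{\sigma\geq1}\mathcal{S}'_{\sigma,\mu}(\mathbb{T}^m\times\mathbb{R}^n)$ such that, for each $f\in\mathcal{S}_{\sigma,\mu}(\mathbb{T}^m\times\mathbb{R}^n)$, $$\langle\check u,f\rangle=\frac1{(2\pi)^n}\int_{\mathbb{T}^m}\int_{\mathbb{R}^n}\int_{\mathbb{R}^n}u(t,\xi)e^{i\xi\cdot x}f(t,x)\,d\xi\,dx\,dt=\frac1{(2\pi)^n}\int_{\mathbb{T}^m}\int_{\mathbb{R}^n}u(t,\xi)\widehat f(t,-\xi)\,d\xi\,dt.$$ Moreover, $\mathcal{F}^{-1}_{\mathbb{R}^n}(u)=\check u$.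
   Context: $\mathbb{T}^m=(\mathbb{R}/2\pi\mathbb{Z})^m$. For $\sigma\ge1$, $\mu\ge1/2$, $C>0$, $\mathcal{S}_{\sigma,\mu,C}(\mathbb{T}^m\times\mathbb{R}^n)$ is the Banach space of $\varphi\in C^\infty(\mathbb{T}^m\times\mathbb{R}^n)$ with $$\sup_{\alpha,\beta\in\mathbb{N}_0^n}\sup_{\gamma\in\mathbb{N}_0^m}C^{-|\alpha+\beta|-|\gamma|}\gamma!^{-\sigma}(\alpha!\beta!)^{-\mu}\sup_{(t,x)\in\mathbb{T}^m\times\mathbb{R}^n}|x^\alpha\partial_x^\beta\partial_t^\gamma\varphi(t,x)|<\infty;$$ $\mathcal{S}_{\sigma,\mu}(\mathbb{T}^m\times\mathbb{R}^n)=\bigcup_{C>0}\mathcal{S}_{\sigma,\mu,C}(\mathbb{T}^m\times\mathbb{R}^n)$ with the inductive limit topology, and $\mathcal{S}'_{\sigma,\mu}(\mathbb{T}^m\times\mathbb{R}^n)$ is the space of (sequentially) continuous linear functionals on it (functionals for larger $\sigma$ restrict to smaller $\sigma$, since the spaces $\mathcal{S}_{\sigma,\mu}$ increase with $\sigma$). The partial Fourier transform is $\widehat f(t,\xi)=\int_{\mathbb{R}^n}f(t,x)e^{-i\xi\cdot x}\,dx$. A function $u$ as in the claim is regarded as the functional $f\mapsto\int_{\mathbb{T}^m}\int_{\mathbb{R}^n}u(t,\xi)f(t,\xi)\,d\xi\,dt$. For $u\in\mathcal{S}'_{\sigma,\mu}(\mathbb{T}^m\times\mathbb{R}^n)$,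 $\mathcal{F}^{-1}_{\mathbb{R}^n}u$ is defined by $\langle\mathcal{F}^{-1}_{\mathbb{R}^n}u,f\rangle=\langle u,\mathcal{F}^{-1}_{\mathbb{R}^n}f\rangle$, where for $f\in\mathcal{S}_{\sigma,\mu}(\mathbb{T}^m\times\mathbb{R}^n)$, $\mathcal{F}^{-1}_{\mathbb{R}^n}(f)(t,x)=\frac1{(2\pi)^n}\int_{\mathbb{R}^n}f(t,\xi)e^{i\xi\cdot x}\,d\xi$.
   Formalization: The triple integral is taken with x innermost, then ξ, then t, because the printed order dξ dx dt diverges (for instance for u = 1); u is assumed Lebesgue measurable. *)

(* Defs.v *)
From HB Require Import structures.
From mathcomp Require Import all_boot all_order all_algebra.
From mathcomp Require Import all_classical all_reals all_analysis.
From mathcomp.real_closed Require Import complex.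
Set Implicit Arguments.
Unset Strict Implicit.
Unset Printing Implicit Defensive.
Import Order.TTheory GRing.Theory Num.Theory.
Import numFieldNormedType.Exports.
Local Open Scope classical_set_scope.
Local Open Scope ring_scope.
Local Open Scope complex_scope.

(* Lebesgue measure on R^n, with its Borel sigma-algebra (generated by the
   coordinate functions). *)

Definition rV_display : measure_display. Proof. exact: default_measure_display. Qed.

Section rV_measurable.
Context {R : realType} (n : nat).

Definition rV_coord (i : 'I_n) (x : 'rV[R]_n) : measurableTypeR R := x ord0 i.

Let rV_set0 : g_sigma_preimage rV_coord set0.
Proof. exact: sigma_algebra0. Qed.

Let rV_setC A : g_sigma_preimage rV_coord A -> g_sigma_preimage rV_coord (~` A).
Proof. exact: sigma_algebraC. Qed.

Let rV_bigcup (F : _^nat) : (forall i, g_sigma_preimage rV_coord (F i)) ->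
  g_sigma_preimage rV_coord (\bigcup_i (F i)).
Proof. exact: sigma_algebra_bigcup. Qed.

HB.instance Definition _ := @isMeasurable.Build rV_display
  'rV[R]_n (g_sigma_preimage rV_coord) rV_set0 rV_setC rV_bigcup.

Lemma measurable_rV_coord (i : 'I_n) :
  measurable_fun [set: 'rV[R]_n] (rV_coord i).
Proof.
move=> _ Y mY; rewrite setTI; apply: sub_sigma_algebra => /=.
rewrite -bigcup_seq/=; exists i => /=; first by rewrite mem_index_enum.
by exists Y => //; rewrite setTI.
Qed.

Lemma measurable_fun_rV d (T : measurableType d) (f : T -> 'rV[R]_n) :
  (forall i, measurable_fun [set: T] (rV_coord i \o f)) ->
  measurable_fun [set: T] f.
Proof.
move=> mf _ A mA; rewrite setTI.
pose P : set (set 'rV[R]_n) := [set B | measurable (f @^-1` B)].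
suff : g_sigma_preimage rV_coord `<=` P by exact.
apply: smallest_sub => [|B].
- split => /= [|B mB|F mF]; rewrite /P /=.
  + by rewrite preimage_set0.
  + by rewrite setTD preimage_setC; exact: measurableC.
  + by rewrite preimage_bigcup; exact: bigcupT_measurable.
rewrite -bigcup_seq => -[i _ [Y mY <-]] /=; rewrite setTI.
by have := mf i measurableT Y mY; rewrite setTI.
Qed.

End rV_measurable.

Section rV_cons.
Context {R : realType} (n : nat).

Definition rV_cons (p : measurableTypeR R * 'rV[R]_n) : 'rV[R]_n.+1 :=
  \row_i oapp (p.2 ord0) p.1 (unlift ord0 i).

Definition rV_uncons (x : 'rV[R]_n.+1) : measurableTypeR R * 'rV[R]_n :=
  (x ord0 ord0, \row_i x ord0 (lift ord0 i)).

Lemma rV_consK : cancel rV_cons rV_uncons.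
Proof.
case=> a v; congr pair; first by rewrite mxE unlift_none.
by apply/rowP => i; rewrite !mxE liftK.
Qed.

Lemma rV_unconsK : cancel rV_uncons rV_cons.
Proof.
move=> x; apply/rowP => i; rewrite mxE.
by case: unliftP => [j|] ->; rewrite //= mxE.
Qed.

Lemma measurable_rV_cons :
  measurable_fun [set: measurableTypeR R * 'rV[R]_n] rV_cons.
Proof.
apply: measurable_fun_rV => i.
have -> : rV_coord i \o rV_cons = fun p => oapp (p.2 ord0) p.1 (unlift ord0 i).
  by apply/funext => p /=; rewrite /rV_coord mxE.
case: unliftP => [j|] _ /=; last exact: measurable_fst.
by apply: (measurableT_comp (@measurable_rV_coord R n j)); exact: measurable_snd.
Qed.

Lemma measurable_rV_uncons : measurable_fun [set: 'rV[R]_n.+1] rV_uncons.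
Proof.
apply: (@measurable_fun_pair _ _ _ _ _ _ (fun x : 'rV[R]_n.+1 => x ord0 ord0 : measurableTypeR R)
  (fun x : 'rV[R]_n.+1 => \row_i x ord0 (lift ord0 i))).
  exact: (@measurable_rV_coord R n.+1 ord0).
apply: measurable_fun_rV => i.
have -> : rV_coord i \o (fun x : 'rV[R]_n.+1 => \row_i x ord0 (lift ord0 i)) =
    @rV_coord R n.+1 (lift ord0 i).
  by apply/funext => x /=; rewrite /rV_coord mxE.
exact: measurable_rV_coord.
Qed.

Variable mu : {sigma_finite_measure set 'rV[R]_n -> \bar R}.

Definition leb_succ : set 'rV[R]_n.+1 -> \bar R :=
  pushforward (@lebesgue_measure R \x mu)%E rV_cons.

Let leb_succ0 : (leb_succ set0 = 0)%E.
Proof. by rewrite /leb_succ /pushforward preimage_set0 measure0. Qed.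

Let leb_succ_ge0 A : (0 <= leb_succ A)%E.
Proof. by rewrite /leb_succ /pushforward measure_ge0. Qed.

Let leb_succ_sigma_additive : semi_sigma_additive leb_succ.
Proof.
have mc A : measurable A -> measurable (rV_cons @^-1` A).
  by move=> mA; rewrite -[X in measurable X]setTI; exact: measurable_rV_cons.
move=> F mF tF mUF; rewrite /leb_succ /pushforward preimage_bigcup.
apply: measure_semi_sigma_additive.
- by move=> k; exact: mc.
- apply/trivIsetP => /= i j _ _ ij; rewrite -preimage_setI.
  by move/trivIsetP : tF => /(_ _ _ _ _ ij) ->//; rewrite preimage_set0.
- by rewrite -preimage_bigcup; exact: mc.
Qed.

HB.instance Definition _ := isMeasure.Build _ _ _ leb_succ
  leb_succ0 leb_succ_ge0 leb_succ_sigma_additive.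

Let leb_succ_sigma_finite : sigma_finite setT leb_succ.
Proof.
have /sigma_finiteP[F [TF ndF Foo]] := sigma_finiteT (@lebesgue_measure R).
have /sigma_finiteP[G [TG ndG Goo]] := sigma_finiteT mu.
exists (fun k => rV_uncons @^-1` (F k `*` G k)).
  rewrite -preimage_bigcup; apply/esym; rewrite -subTset => x _.
  have [i _ Fi] : (\bigcup_i F i) (rV_uncons x).1 by rewrite -TF.
  have [j _ Gj] : (\bigcup_i G i) (rV_uncons x).2 by rewrite -TG.
  exists (maxn i j) => //; split.
    by move: Fi; exact/subsetPset/ndF/leq_maxl.
  by move: Gj; exact/subsetPset/ndG/leq_maxr.
move=> k; have [mF Fk] := Foo k; have [mG Gk] := Goo k; split.
  rewrite -[X in measurable X]setTI; apply: measurable_rV_uncons => //.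
  exact: measurableX.
rewrite /leb_succ /pushforward -comp_preimage.
rewrite (_ : rV_uncons \o rV_cons = id); last exact/funext/rV_consK.
rewrite preimage_id product_measure1E// lte_mul_pinfty// ge0_fin_numE//.
Qed.

HB.instance Definition _ := Measure_isSigmaFinite.Build _ _ _ leb_succ
  leb_succ_sigma_finite.

End rV_cons.

Fixpoint leb (R : realType) n : {sigma_finite_measure set 'rV[R]_n -> \bar R} :=
  match n with
  | 0 => \d_(0 : 'rV[R]_0)
  | n'.+1 => leb_succ (leb R n')
  end.

Lemma leb_box (R : realType) n (a b : 'I_n -> R) : (forall i, a i <= b i) ->
  leb R n [set x | forall i, a i < x ord0 i <= b i] = (\prod_i (b i - a i))%:E.
Proof.
elim: n a b => [|n IH] a b ab.
  rewrite big_ord0 /=.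
  rewrite -(diracT R (0 : 'rV[R]_0)).
  by congr (dirac _ _); apply/seteqP; split => // x _ [].
rewrite big_ord_recl /= /leb_succ /pushforward.
have mB : measurable [set x : 'rV[R]_n |
    forall i, a (lift ord0 i) < x ord0 i <= b (lift ord0 i)].
  rewrite (_ : [set _ | _] =
      \bigcap_(i in [set: 'I_n]) (rV_coord i @^-1` `]a (lift ord0 i), b (lift ord0 i)])).
    apply: fin_bigcap_measurable => // i _.
    by rewrite -[X in measurable X]setTI; apply: measurable_rV_coord.
  by apply/seteqP; split => x /= H i => [_|]; have := H i; rewrite /= in_itv/=; [|exact].
rewrite (_ : _ @^-1` _ = `]a ord0, b ord0]%classic `*`
    [set x : 'rV[R]_n | forall i, a (lift ord0 i) < x ord0 i <= b (lift ord0 i)]).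
  rewrite product_measure1E// IH//= lebesgue_measure_itv/= lte_fin.
  have := ab ord0; rewrite le_eqVlt => /orP[/eqP ->|->]; rewrite ?ltxx ?subrr ?mul0r ?mul0e ?EFinM //.
apply/seteqP; split => -[x y] /=.
  move=> H; split; first by have := H ord0; rewrite mxE unlift_none/= in_itv.
  by move=> i; have := H (lift ord0 i); rewrite mxE liftK.
rewrite in_itv/= => -[Hx H] i; rewrite mxE.
by case: unliftP => [j|] ->.
Qed.

Section complex_calculus.
Context {R : realType}.

Definition expi (x : R) : R[i] := cos x +i* sin x.

Definition cintegral d (T : measurableType d) (mu : {measure set T -> \bar R})
    (D : set T) (f : T -> R[i]) : R[i] :=
  (\int[mu]_(x in D) complex.Re (f x)) +i* (\int[mu]_(x in D) complex.Im (f x)).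

(* Derivative of a complex-valued function in the real direction v. *)
Definition cderive (V : normedModType R) (v : V) (f : V -> R[i]) : V -> R[i] :=
  fun p => 'D_v (fun q => complex.Re (f q)) p +i*
           'D_v (fun q => complex.Im (f q)) p.

Definition cderivable (V : normedModType R) (v : V) (f : V -> R[i]) :=
  forall p, derivable (fun q => complex.Re (f q)) p v /\
            derivable (fun q => complex.Im (f q)) p v.

Definition ccontinuous (T : topologicalType) (f : T -> R[i]) :=
  continuous (fun q => complex.Re (f q)) /\
  continuous (fun q => complex.Im (f q)).

(* All iterated partial derivatives, along the directions e i, of order at
   most k exist and are continuous. *)
Fixpoint cont_diff (V : normedModType R) (I : Type) (e : I -> V) (k : nat)
    (f : V -> R[i]) : Prop :=
  ccontinuous f /\
  if k is k'.+1 then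
    forall i, cderivable (e i) f /\ cont_diff e k' (cderive (e i) f)
  else True.

Definition multi_derive (V : normedModType R) r (e : 'I_r -> V)
    (a : 'I_r -> nat) (f : V -> R[i]) : V -> R[i] :=
  foldr (fun i g => iter (a i) (cderive (e i)) g) f (enum 'I_r).

End complex_calculus.

(* Functions on T^m x R^n are functions of (t, x) : R^m x R^n that are
   2pi-periodic in each coordinate of t; an integral over T^m is an integral
   over the fundamental domain [0, 2pi)^m. *)

Section gelfand_shilov.
Context {R : realType} {m n : nat}.
Local Notation E := ('rV[R]_m * 'rV[R]_n)%type.
Implicit Types (phi f : E -> R[i]) (sigma mu C : R) (T : (E -> R[i]) -> R[i]).

Definition torus_periodic f := forall (i : 'I_m) t x,
  f (t + (2 * pi) *: delta_mx ord0 i, x) = f (t, x).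

Definition torus_cell : set 'rV[R]_m :=
  [set t | forall i, 0 <= t ord0 i < 2 * pi].

Definition dir_t (i : 'I_m) : E := (delta_mx ord0 i, 0).
Definition dir_x (j : 'I_n) : E := (0, delta_mx ord0 j).
Definition dir (k : 'I_m + 'I_n) : E :=
  match k with inl i => dir_t i | inr j => dir_x j end.

Definition smooth f := forall k, cont_diff dir k f.

Definition mlength r (a : 'I_r -> nat) : nat := (\sum_i a i)%N.
Definition mfact r (a : 'I_r -> nat) : R := \prod_i (a i)`!%:R.
Definition mpow (x : 'rV[R]_n) (a : 'I_n -> nat) : R :=
  \prod_j x ord0 j ^+ a j.

Definition GS_norm sigma mu C phi : \bar R :=
  ereal_sup [set y | exists (alpha beta : 'I_n -> nat) (gamma : 'I_m -> nat)
                            (p : E),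
    y = (C ^- (mlength alpha + mlength beta + mlength gamma)
         * mfact gamma `^ (- sigma) * (mfact alpha * mfact beta) `^ (- mu)
         * Normc.normc ((mpow p.2 alpha)%:C *
             multi_derive dir_x beta (multi_derive dir_t gamma phi) p))%:E].

Definition GS_C sigma mu C : set (E -> R[i]) :=
  [set phi | [/\ smooth phi, torus_periodic phi &
                (GS_norm sigma mu C phi < +oo)%E]].

Definition GS sigma mu : set (E -> R[i]) :=
  \bigcup_(C in [set C | 0 < C]) GS_C sigma mu C.

Definition absolutely_convex (V : set (E -> R[i])) :=
  forall f g (a b : R[i]), V f -> V g -> Normc.normc a + Normc.normc b <= 1 ->
    V (fun p => a * f p + b * g p).

(* The locally convex inductive limit topology on the union of the Banach
   spaces GS_C: a base of neighbourhoods of 0 consists of the absolutely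
   convex sets whose trace on every GS_C is a neighbourhood of 0. *)
Definition GS_nbhs0_base sigma mu : set (set (E -> R[i])) :=
  [set V | [/\ V `<=` GS sigma mu, absolutely_convex V &
    forall C, 0 < C -> exists2 r : R, 0 < r &
      forall phi, GS_C sigma mu C phi -> (GS_norm sigma mu C phi < r%:E)%E ->
        V phi]].

Definition GS_nbhs sigma mu phi : set_system (E -> R[i]) :=
  [set U | exists2 V, GS_nbhs0_base sigma mu V &
    forall psi, V psi -> U (fun p => phi p + psi p)].

(* Functionals are total Rocq functions of which only the values on
   GS sigma mu matter; restriction to a smaller space is then implicit. *)
Definition GS_dual sigma mu : set ((E -> R[i]) -> R[i]) :=
  [set T | (forall f g (a : R[i]), GS sigma mu f -> GS sigma mu g ->
              T (fun p => a * f p + g p) = a * T f + T g) /\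
           (forall phi, GS sigma mu phi -> forall e : R, 0 < e ->
              \forall g \near GS_nbhs sigma mu phi,
                Normc.normc (T g - T phi) < e)].

Definition dotr (x y : 'rV[R]_n) : R := \sum_j x ord0 j * y ord0 j.
Definition enorm (x : 'rV[R]_n) : R := Num.sqrt (dotr x x).

Definition fourier f : E -> R[i] := fun p =>
  cintegral (leb R n) setT (fun x => f (p.1, x) * expi (- dotr p.2 x)).

Definition inv_fourier f : E -> R[i] := fun p =>
  ((2 * pi) ^- n)%:C *
  cintegral (leb R n) setT (fun xi => f (p.1, xi) * expi (dotr xi p.2)).

Definition inv_fourier_dual T : (E -> R[i]) -> R[i] :=
  fun f => T (inv_fourier f).

Definition functional_of (u : E -> R[i]) : (E -> R[i]) -> R[i] := fun f =>
  cintegral (leb R m) torus_cell (fun t =>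
    cintegral (leb R n) setT (fun xi => u (t, xi) * f (t, xi))).

(* Lebesgue measurability: the sigma-algebra on R^m x R^n is the Borel one, of
   which the Lebesgue sigma-algebra is the completion. *)
Definition lebesgue_measurable (u : E -> R[i]) :=
  exists v : E -> R[i],
    [/\ measurable_fun [set: E] (fun p => complex.Re (v p)),
        measurable_fun [set: E] (fun p => complex.Im (v p)) &
        {ae (leb R m \x leb R n)%E, forall p, u p = v p}].

End gelfand_shilov.
Arguments GS {R} m n sigma mu.
Arguments GS_dual {R} m n sigma mu.
Arguments torus_cell R m : clear implicits.

(* Main.v *)
Require Import Defs.
From mathcomp Require Import all_boot all_order all_algebra.
From mathcomp Require Import all_classical all_reals all_analysis.
From mathcomp.real_closed Require Import complex.
From mathcomp Require Import measurable_realfun ring.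
Import Order.TTheory GRing.Theory Num.Theory.
Import numFieldNormedType.Exports.
Local Open Scope classical_set_scope.
Local Open Scope ring_scope.
Local Open Scope complex_scope.

(** The functional of the inverse transform is [ucheck f = <u, F^-1 f>], so that the
    identity [F^-1 u = ucheck] is its definition, and the two integral formulas are
    rearrangements of the innermost integral. What has to be proved is that [u] and
    [ucheck] are continuous functionals on every space of the scale, and this follows
    from the decay of [f] and of its partial Fourier integral.

    A linear functional is continuous for the inductive limit topology as soon as it
    is bounded on each step of the limit ([GS_dual_bounded]). Let [f] be of norm at
    most [r] in the step [C]. The seminorms bound [|x_i|^l |d_j^k f|] by
    [r C^(k+l) (k! l!)^mu]. Taking [mu]-th roots and summing over [l] turns such
    bounds into exponential decay, [|d_j^k f| <= const r C^k k!^mu exp (- a |x|^(1/mu))]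
    with a rate [a > 0] that depends on [n], [mu] and [C] only ([exp_decay]).
    Integration by parts in the [j]-th variable, [k] times, transfers the powers:
    [|xi_j|^k |F^-1 f|] is bounded by a constant times the integral of [|d_j^k f|],
    thus by [const r C^k k!^mu], and the same summation shows that [F^-1 f] decays
    like [exp (- a |xi|^(1/mu))] ([wave_integral_decay]).

    The hypothesis on [u], used with [eps = a / 2], leaves an integrand bounded by
    [const r exp (- a/2 |xi|^(1/mu))], which is dominated by the integrable weight
    [prod_j 1 / (1 + xi_j^2)] ([decay_dominated]). This gives absolute convergence,
    linearity and the bound on each step at once.

    The remaining work is measure-theoretic. The function [u] is only equal almost
    everywhere to a Borel function, so its iterated integrals are computed with a Borel
    representative that satisfies the same pointwise bound ([borel_representative]);
    Lebesgue integrals of arbitrary functions ignore null sets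
    ([ae_eq_integral_nomeas]). Smooth functions are Borel because they are limits of
    their samples on grids ([continuous_measurable_rV2]), and the integral over R^n of
    a partial derivative vanishes by Fubini's theorem and the fundamental theorem of
    calculus ([integral_partial0]). *)

(** * Complex numbers *)

Section complex_norm.
Context {R : realType}.
Implicit Types z w : R[i].

Lemma ReM z w : complex.Re (z * w) =
  complex.Re z * complex.Re w - complex.Im z * complex.Im w.
Proof. by case: z; case: w. Qed.

Lemma ImM z w : complex.Im (z * w) =
  complex.Re z * complex.Im w + complex.Im z * complex.Re w.
Proof. by case: z; case: w => c d a b /=; rewrite [b * c]mulrC. Qed.

Lemma ReD z w : complex.Re (z + w) = complex.Re z + complex.Re w.
Proof. by case: z; case: w. Qed.

Lemma ImD z w : complex.Im (z + w) = complex.Im z + complex.Im w.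
Proof. by case: z; case: w. Qed.

Lemma complex_eta z : z = complex.Re z +i* complex.Im z.
Proof. by case: z. Qed.

Lemma normc_ge0 z : 0 <= Normc.normc z.
Proof. by case: z => a b; exact: sqrtr_ge0. Qed.

Lemma normc_real (x : R) : Normc.normc x%:C = `|x|.
Proof. by rewrite /= expr0n addr0 sqrtr_sqr. Qed.

Lemma le_Re_normc z : `|complex.Re z| <= Normc.normc z.
Proof. by case: z => a b /=; rewrite -sqrtr_sqr ler_wsqrtr// lerDl sqr_ge0. Qed.

Lemma le_Im_normc z : `|complex.Im z| <= Normc.normc z.
Proof. by case: z => a b /=; rewrite -sqrtr_sqr ler_wsqrtr// lerDr sqr_ge0. Qed.

Lemma normc_le_ReIm z : Normc.normc z <= `|complex.Re z| + `|complex.Im z|.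
Proof.
case: z => a b /=; rewrite -[leRHS]ger0_norm ?addr_ge0// -[leRHS]sqrtr_sqr.
rewrite ler_wsqrtr // sqrrD -!normrX (ger0_norm (sqr_ge0 a)) (ger0_norm (sqr_ge0 b)).
by rewrite addrAC lerDl mulrn_wge0 // mulr_ge0.
Qed.

Lemma normc_expi (x : R) : Normc.normc (expi x) = 1.
Proof. by rewrite /= cos2Dsin2 sqrtr1. Qed.

End complex_norm.

(** * Integrals of real and complex functions *)

Section unmeasurable_integrals.
Context {d} {T : measurableType d} {R : realType}.
Variable mu : {measure set T -> \bar R}.
Local Open Scope ereal_scope.
Import HBNNSimple.

(** The integral of a nonnegative function is a supremum over the simple
    functions below it, hence it is monotone even for integrands that are not
    measurable. *)
Lemma ge0_le_integral_nomeas (D : set T) (f g : T -> \bar R) :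
  (forall x, D x -> 0 <= f x) -> (forall x, D x -> f x <= g x) ->
  \int[mu]_(x in D) f x <= \int[mu]_(x in D) g x.
Proof.
move=> f0 fg; rewrite !ge0_integralE//; last first.
  by move=> x Dx; rewrite (le_trans (f0 x Dx))// fg.
apply: le_ereal_sup => _ [h hf <-]; exists h => // x.
by rewrite (le_trans (hf x))// lee_restrict.
Qed.

(** A simple function below [f] can be set to zero on a null set without
    changing its integral, and is then below any [g] that agrees with [f]
    elsewhere: so the integral ignores null sets, measurable integrand or not. *)
Lemma ae_eq_integral_nomeas (D : set T) (f g : T -> \bar R) :
  {ae mu, forall x, D x -> f x = g x} ->
  \int[mu]_(x in D) f x = \int[mu]_(x in D) g x.
Proof.
move=> [N [mN N0 fgN]].
have {}fgN x : ~ N x -> D x -> f x = g x.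
  by move=> Nx; apply: contrapT => /fgN.
have nn (f1 g1 : T -> \bar R) : (forall x, 0 <= f1 x) -> (forall x, 0 <= g1 x) ->
    (forall x, ~ N x -> f1 x = g1 x) -> \int[mu]_x f1 x <= \int[mu]_x g1 x.
  move=> f0 g0 fg; rewrite !ge0_integralTE//; apply: ge_ereal_sup => _ [h hf <-].
  apply: le_ereal_sup_tmp; exists (sintegral mu (proj_nnsfun h (measurableC mN))).
    exists (proj_nnsfun h (measurableC mN)) => // x.
    rewrite /= mindicE; have [/[!inE] Nx|_] := boolP (x \in ~` N).
      by rewrite mulr1 -fg// hf.
    by rewrite mulr0 g0.
  rewrite -!integralT_nnsfun le_eqVlt; apply/orP; left; apply/eqP.
  apply: ge0_ae_eq_integral => //.
  - by apply/measurable_EFinP.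
  - by apply/measurable_EFinP.
  - by move=> x _; rewrite lee_fin.
  - by move=> x _; rewrite lee_fin.
  exists N; split => // x /=; apply: contra_notP => Nx _.
  by rewrite /= mindicE mem_set// mulr1.
have nnE (f1 g1 : T -> \bar R) : (forall x, 0 <= f1 x) -> (forall x, 0 <= g1 x) ->
    (forall x, ~ N x -> f1 x = g1 x) -> \int[mu]_x f1 x = \int[mu]_x g1 x.
  move=> f0 g0 fg; apply/eqP; rewrite eq_le !nn//.
  by move=> x Nx; rewrite fg.
rewrite integral_mkcond [RHS]integral_mkcond integralE [RHS]integralE.
have fg x : ~ N x -> (f \_ D) x = (g \_ D) x.
  by move=> Nx; rewrite !patchE; case: ifPn => // /[!inE] Dx; exact: fgN.
congr (_ - _); apply: nnE => // x Nx; last by rewrite !funenegE fg.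
by rewrite !funeposE fg.
Qed.

End unmeasurable_integrals.

Section complex_integrals.
Context {R : realType}.

Definition cmeasurable {d} {T : measurableType d} (f : T -> R[i]) :=
  measurable_fun [set: T] (fun x => complex.Re (f x)) /\
  measurable_fun [set: T] (fun x => complex.Im (f x)).

Definition cintegrable {d} {T : measurableType d} (mu : {measure set T -> \bar R})
    (D : set T) (f : T -> R[i]) :=
  mu.-integrable D (EFin \o (fun x => complex.Re (f x))) /\
  mu.-integrable D (EFin \o (fun x => complex.Im (f x))).

Section one_space.
Context {d} {T : measurableType d}.
Implicit Types f g : T -> R[i].

Lemma cmeasurable_cst (c : R[i]) : cmeasurable (fun _ : T => c).
Proof. by split; exact: measurable_cst. Qed.

Lemma cmeasurableM f g : cmeasurable f -> cmeasurable g ->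
  cmeasurable (fun x => f x * g x).
Proof.
move=> [f1 f2] [g1 g2]; split.
  under eq_fun do rewrite ReM.
  by apply: measurable_funB; apply: measurable_funM.
under eq_fun do rewrite ImM.
by apply: measurable_funD; apply: measurable_funM.
Qed.

Lemma cmeasurableD f g : cmeasurable f -> cmeasurable g ->
  cmeasurable (fun x => f x + g x).
Proof.
move=> [f1 f2] [g1 g2]; split.
  by under eq_fun do rewrite ReD; apply: measurable_funD.
by under eq_fun do rewrite ImD; apply: measurable_funD.
Qed.

Lemma cmeasurable_comp {d'} {T' : measurableType d'} (h : T' -> T) f :
  measurable_fun [set: T'] h -> cmeasurable f -> cmeasurable (fun x => f (h x)).
Proof.
by move=> mh [f1 f2]; split; [exact: measurableT_comp f1 mh|
  exact: measurableT_comp f2 mh].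
Qed.

Lemma cmeasurable_expi (h : T -> R) : measurable_fun [set: T] h ->
  cmeasurable (fun x => expi (h x)).
Proof.
move=> mh; split => /=; apply: measurableT_comp mh.
  by apply: continuous_measurable_fun; exact: continuous_cos.
by apply: continuous_measurable_fun; exact: continuous_sin.
Qed.

Variable mu : {measure set T -> \bar R}.

Lemma cintegrable_le (D : set T) f (g : T -> R) : measurable D -> cmeasurable f ->
  (forall x, D x -> Normc.normc (f x) <= g x) ->
  mu.-integrable D (EFin \o g) -> cintegrable mu D f.
Proof.
move=> mD [f1 f2] fg ig; split; apply: (le_integrable mD _ _ ig).
- by apply/measurable_EFinP; exact: measurable_funTS.
- move=> x Dx /=; rewrite lee_fin (le_trans (le_Re_normc _))//.
  by rewrite (le_trans (fg x Dx))// ler_norm.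
- by apply/measurable_EFinP; exact: measurable_funTS.
- move=> x Dx /=; rewrite lee_fin (le_trans (le_Im_normc _))//.
  by rewrite (le_trans (fg x Dx))// ler_norm.
Qed.

Lemma normc_cintegral_le (D : set T) f (g : T -> R) : measurable D ->
  cmeasurable f -> (forall x, D x -> Normc.normc (f x) <= g x) ->
  mu.-integrable D (EFin \o g) ->
  Normc.normc (cintegral mu D f) <= 2 * \int[mu]_(x in D) g x.
Proof.
move=> mD mf fg ig; have [i1 i2] := cintegrable_le D f g mD mf fg ig.
rewrite (le_trans (normc_le_ReIm _))//= mulr_natl mulr2n lerD//.
  rewrite (le_trans (le_normr_Rintegral _ _))//.
  apply: le_Rintegral => //; first exact: integrable_norm.
  by move=> x Dx; rewrite (le_trans (le_Re_normc _))// fg.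
rewrite (le_trans (le_normr_Rintegral _ _))//.
apply: le_Rintegral => //; first exact: integrable_norm.
by move=> x Dx; rewrite (le_trans (le_Im_normc _))// fg.
Qed.

Lemma cintegral_linear (D : set T) f g (a b : R[i]) : measurable D ->
  cintegrable mu D f -> cintegrable mu D g ->
  cintegral mu D (fun x => a * f x + b * g x) =
  a * cintegral mu D f + b * cintegral mu D g.
Proof.
move=> mD [f1 f2] [g1 g2].
have iZ (k : R) (h : T -> R) : mu.-integrable D (EFin \o h) ->
    mu.-integrable D (EFin \o (fun x => k * h x)).
  by move=> ih; exact: (integrableZl mD k ih).
have iD (h k : T -> R) : mu.-integrable D (EFin \o h) ->
    mu.-integrable D (EFin \o k) ->
    mu.-integrable D (EFin \o (fun x => h x + k x)).
  by move=> ih ik; exact: (integrableD mD ih ik).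
have iB (h k : T -> R) : mu.-integrable D (EFin \o h) ->
    mu.-integrable D (EFin \o k) ->
    mu.-integrable D (EFin \o (fun x => h x - k x)).
  by move=> ih ik; exact: (integrableB mD ih ik).
apply/eqP; rewrite eq_complex; apply/andP; split; apply/eqP.
  rewrite ReD !ReM /=; under eq_Rintegral do rewrite ReD !ReM.
  by rewrite RintegralD ?RintegralB ?RintegralZl//;
    try (apply: iB; exact: iZ); exact: iZ.
rewrite ImD !ImM /=; under eq_Rintegral do rewrite ImD !ImM.
by rewrite !RintegralD ?RintegralZl//; try (apply: iD; exact: iZ); exact: iZ.
Qed.

Lemma cintegralZl (D : set T) f (a : R[i]) : measurable D ->
  cintegrable mu D f ->
  cintegral mu D (fun x => a * f x) = a * cintegral mu D f.
Proof.
move=> mD fi; have := cintegral_linear D f f a 0 mD fi fi.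
rewrite mul0r addr0 => <-; congr (cintegral _ _ _); apply/funext => x.
by rewrite mul0r addr0.
Qed.

Lemma eq_cintegral (D : set T) f g : (forall x, D x -> f x = g x) ->
  cintegral mu D f = cintegral mu D g.
Proof.
move=> fg; apply/eqP; rewrite eq_complex; apply/andP; split; apply/eqP => /=;
  by apply: eq_Rintegral => x /[!inE] Dx; rewrite fg.
Qed.

Lemma ae_eq_cintegral (D : set T) f g : {ae mu, forall x, D x -> f x = g x} ->
  cintegral mu D f = cintegral mu D g.
Proof.
move=> fg; apply/eqP; rewrite eq_complex; apply/andP; split; apply/eqP => /=;
  congr fine; apply: ae_eq_integral_nomeas;
  by apply: filterS fg => x + Dx => ->.
Qed.

End one_space.

Lemma cmeasurable_cintegral {d1 d2} {T1 : measurableType d1}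
    {T2 : measurableType d2} (m2 : {sigma_finite_measure set T2 -> \bar R})
    (f : T1 * T2 -> R[i]) : cmeasurable f ->
  cmeasurable (fun x => cintegral m2 setT (fun y => f (x, y))).
Proof.
have mint (g : T1 * T2 -> R) : measurable_fun [set: T1 * T2] g ->
    measurable_fun [set: T1] (fun x => \int[m2]_(y in setT) g (x, y)).
  move=> mg; rewrite /Rintegral.
  apply: measurableT_comp; first exact: fine_measurable.
  have mG : measurable_fun [set: T1 * T2] (EFin \o g) by exact/measurable_EFinP.
  rewrite (_ : (fun x => _) = (fun x => \int[m2]_y ((EFin \o g)^\+ (x, y)) -
      \int[m2]_y ((EFin \o g)^\- (x, y)))%E); last first.
    apply/funext => x; rewrite integralE; congr (_ - _)%E.
      by apply: eq_integral => y _; rewrite !funeposE.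
    by apply: eq_integral => y _; rewrite !funenegE.
  apply: emeasurable_funB.
    by apply: measurable_fun_fubini_tonelli_F => //; exact: measurable_funepos.
  by apply: measurable_fun_fubini_tonelli_F => //; exact: measurable_funeneg.
by move=> [f1 f2]; split; [exact: (mint _ f1)|exact: (mint _ f2)].
Qed.

End complex_integrals.

(** * An integrable weight on R^n *)

Section weight.
Context {R : realType}.

(** A product of functions of one variable, so that its integrability and every
    use of it under Fubini's theorem reduce to [1 / (1 + a^2)] on the line. *)
Definition weight {n} (x : 'rV[R]_n) : R := \prod_j (1 + x ord0 j ^+ 2)^-1.

Lemma weight_gt0 n (x : 'rV[R]_n) : 0 < weight x.
Proof. by apply: prodr_gt0 => i _; rewrite invr_gt0 ltr_pwDl// sqr_ge0. Qed.

Lemma weight_rV_cons n a (v : 'rV[R]_n) :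
  weight (rV_cons (a, v)) = (1 + a ^+ 2)^-1 * weight v.
Proof.
rewrite /weight big_ord_recl mxE unlift_none; congr (_ * _).
by apply: eq_bigr => i _; rewrite mxE liftK.
Qed.

Lemma measurable_weight n : measurable_fun [set: 'rV[R]_n] weight.
Proof.
have -> : @weight n = (fun x => \prod_(j <- enum 'I_n) (1 + x ord0 j ^+ 2)^-1).
  by apply/funext => x; rewrite big_enum.
elim: (enum 'I_n) => [|j s IH].
  by under eq_fun do rewrite big_nil; exact: measurable_cst.
under eq_fun do rewrite big_cons; apply: measurable_funM => //.
apply: (@measurableT_comp _ _ _ _ _ _ (fun a : R => (1 + a ^+ 2)^-1) _
  (@rV_coord R n j) _ (@measurable_rV_coord R n j)).
by apply: continuous_measurable_fun => x; exact: continuous_oneDsqrV.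
Qed.

Lemma ge0_integral_leb_succ n (f : 'rV[R]_n.+1 -> \bar R) :
  measurable_fun [set: 'rV[R]_n.+1] f -> (forall x, 0 <= f x)%E ->
  (\int[leb R n.+1]_x f x =
   \int[@lebesgue_measure R]_a \int[leb R n]_v f (rV_cons (a, v)))%E.
Proof.
move=> mf f0.
transitivity (\int[(@lebesgue_measure R \x leb R n)%E]_p (f \o @rV_cons R n) p)%E.
  apply: (ge0_integral_pushforward (@measurable_rV_cons R n)).
  - exact: measurableT.
  - exact: mf.
  - by move=> x _; exact: f0.
rewrite fubini_tonelli1//=; apply: measurableT_comp => //.
exact: measurable_rV_cons.
Qed.

Lemma integral_oneDsqrV_lty :
  (\int[@lebesgue_measure R]_a ((1 + a ^+ 2)^-1)%:E < +oo)%E.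
Proof.
rewrite ge0_symfun_integralT//.
- rewrite -set_itvcy (_ : \int[_]_(_ in _) _ = (pi / 2)%:E)%E ?ltry//.
  exact: integral0y_oneDsqr.
- by move=> x; rewrite invr_ge0 addr_ge0// sqr_ge0.
- by move=> x; exact: continuous_oneDsqrV.
- by move=> x /=; rewrite sqrrN.
Qed.

Lemma integral_weight_lty n : (\int[leb R n]_x (weight x)%:E < +oo)%E.
Proof.
elim: n => [|n IH].
  rewrite /= integral_dirac//; last first.
    by apply/measurable_EFinP; exact: measurable_weight.
  by rewrite diracT mul1e ltry.
rewrite ge0_integral_leb_succ; last 2 first.
- by apply/measurable_EFinP; exact: measurable_weight.
- by move=> x; rewrite lee_fin ltW// weight_gt0.
have IH0 : (0 <= \int[leb R n]_x (weight x)%:E)%E.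
  by apply: integral_ge0 => x _; rewrite lee_fin ltW// weight_gt0.
under eq_integral => a _.
  under eq_integral do rewrite weight_rV_cons EFinM.
  rewrite ge0_integralZl//; last 3 first.
  - by apply/measurable_EFinP; exact: measurable_weight.
  - by move=> x _; rewrite lee_fin ltW// weight_gt0.
  - by rewrite lee_fin invr_ge0 addr_ge0// sqr_ge0.
  over.
have i0 : (0 <= \int[@lebesgue_measure R]_a ((1 + a ^+ 2)^-1)%:E)%E.
  by apply: integral_ge0 => x _; rewrite lee_fin invr_ge0 addr_ge0// sqr_ge0.
rewrite ge0_integralZr//.
- rewrite lte_mul_pinfty// ge0_fin_numE//; exact: integral_oneDsqrV_lty.
- apply/measurable_EFinP; apply: continuous_measurable_fun.
  by move=> x; exact: continuous_oneDsqrV.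
- by move=> x _; rewrite lee_fin invr_ge0 addr_ge0// sqr_ge0.
Qed.

Lemma integrable_weight n (K : R) :
  (leb R n).-integrable setT (EFin \o (fun x => K * weight x)).
Proof.
apply: (@integrableZl _ _ _ _ _ measurableT K (EFin \o weight)).
apply/integrableP; split.
  by apply/measurable_EFinP; exact: measurable_weight.
under eq_integral => x _.
  rewrite gee0_abs; last by rewrite /= lee_fin ltW// weight_gt0.
  over.
exact: integral_weight_lty.
Qed.

Lemma integrable_oneDsqrV (K : R) :
  (@lebesgue_measure R).-integrable setT
    (EFin \o (fun a => K * (1 + a ^+ 2)^-1)).
Proof.
have i1 : (@lebesgue_measure R).-integrable setT
    (EFin \o (fun a => (1 + a ^+ 2)^-1)).
  apply/integrableP; split.
    apply/measurable_EFinP; apply: continuous_measurable_fun.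
    by move=> x; exact: continuous_oneDsqrV.
  under eq_integral => x _.
    rewrite gee0_abs; last by rewrite /= lee_fin invr_ge0 addr_ge0// sqr_ge0.
    over.
  exact: integral_oneDsqrV_lty.
exact: (integrableZl measurableT K i1).
Qed.

End weight.

(** * Integrals of partial derivatives *)

Section vanishing_integral.
Context {R : realType}.

(** A directional derivative only sees one line. This moves it between a product
    space, the slices of that product and the real line, where calculus in one
    variable applies. *)
Lemma is_derive_line {V W : normedModType R} (a v : V) (b w : W)
    (f : V -> R) (g : W -> R) (d : R) :
  (forall h : R, f (h *: v + a) = g (h *: w + b)) ->
  is_derive a v f d -> is_derive b w g d.
Proof.
move=> fg.
have q : (fun h => h^-1 *: ((f \o shift a) (h *: v) - f a)) =
    (fun h => h^-1 *: ((g \o shift b) (h *: w) - g b)).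
  apply/funext => h /=; rewrite fg; congr (_ *: (_ - _)).
  by have := fg 0; rewrite !scale0r !add0r.
by move=> [df dfE]; split; move: df dfE; rewrite /derivable /derive q.
Qed.

Lemma is_derive_alongP {V : normedModType R} (x v : V) (f : V -> R) (d : R) :
  is_derive x v f d <->
  is_derive (0 : R) (1 : R) (fun h => f (h *: v + x)) d.
Proof.
have along (h : R) : (fun h : R => f (h *: v + x)) (h *: (1 : R) + 0 : R) =
    f (h *: v + x).
  by rewrite addr0 /GRing.scale /= mulr1.
split; last exact: (is_derive_line _ _ _ _ _ _ _ along).
by apply: (is_derive_line _ _ _ _ f) => h; rewrite -along.
Qed.

(** By the fundamental theorem the integral over [-k-1, k+1] is an increment of
    [F], which vanishes in the limit. *)
Lemma integral_derive0 (F G : R -> R) (K : R) :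
  (forall x : R, is_derive x (1 : R) F (G x)) -> continuous G ->
  (forall x, `|F x| <= K * (1 + x ^+ 2)^-1) ->
  (forall x, `|G x| <= K * (1 + x ^+ 2)^-1) ->
  (\int[@lebesgue_measure R]_x (G x)%:E = 0)%E.
Proof.
move=> dF cG bF bG.
have mG : measurable_fun [set: R] G by exact: continuous_measurable_fun.
pose I (k : nat) : set R := `[- k.+1%:R, k.+1%:R]%classic.
have mI k : measurable (I k) by exact: measurable_itv.
have K0 : 0 <= K.
  have := le_trans (normr_ge0 _) (bF 0).
  by rewrite expr0n addr0 invr1 mulr1.
have FTC k : (\int[@lebesgue_measure R]_(x in I k) (G x)%:E =
    (F k.+1%:R - F (- k.+1%:R))%:E)%E.
  rewrite EFinB; apply: continuous_FTC2.
  - by rewrite gtrN.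
  - exact: continuous_subspaceT.
  - have cF : continuous F.
      move=> x; apply: differentiable_continuous; apply/derivable1_diffP.
      by apply: ex_derive; exact: dF.
    split; first by move=> x _; apply: ex_derive; exact: dF.
      by apply: cvg_at_right_filter; exact: cF.
    by apply: cvg_at_left_filter; exact: cF.
  - by move=> x _; rewrite derive1E; apply: derive_val; exact: dF.
have lim0 : (\int[@lebesgue_measure R]_(x in I k) (G x)%:E)%E @[k --> \oo] -->
    (0%:E : \bar R).
  under eq_fun do rewrite FTC.
  apply: cvg_EFin; first exact: nearW.
  apply/norm_cvg0P.
  apply: (@squeeze_cvgr _ _ _ _ (cst 0) (fun k => (2 * K) * harmonic k)).
  - apply: nearW => k; rewrite normr_ge0/=.
    rewrite (le_trans (ler_normB _ _))// [2 * K]mulr_natl mulr2n mulrDl.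
    have q : K * (1 + k.+1%:R ^+ 2)^-1 <= K * k.+1%:R^-1.
      have p : 0 < 1 + k.+1%:R ^+ 2 :> R by rewrite ltr_pwDl// sqr_ge0.
      rewrite ler_wpM2l// lef_pV2 ?posrE//.
      by rewrite -natrX nat1r ler_nat expnS expn1 leqW// leq_pmulr.
    rewrite lerD// (le_trans (bF _))//.
    by rewrite sqrrN.
  - exact: cvg_cst.
  - by rewrite -[X in _ --> X](mulr0 (2 * K)); apply: cvgMr; exact: cvg_harmonic.
have domcvg : (\int[@lebesgue_measure R]_(x in I k) (G x)%:E)%E @[k --> \oo] -->
    (\int[@lebesgue_measure R]_x (G x)%:E)%E.
  have [||||| _ _] := @dominated_convergence _ _ R (@lebesgue_measure R) setT
    measurableT (fun k => (EFin \o G) \_ (I k)) (EFin \o G)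
    (EFin \o (fun a => K * (1 + a ^+ 2)^-1)).
  - move=> k; apply: (measurable_restrictT _ (mI k)).1.
    by apply: measurable_funTS; exact/measurable_EFinP.
  - exact/measurable_EFinP.
  - apply: aeW => x _; apply: cvg_near_cst; near=> k.
    rewrite patchE mem_set// /I /= in_itv /= -ler_norml.
    rewrite (@le_trans _ _ k%:R) ?ler_nat//; near: k; exact: nbhs_infty_ger.
  - exact: integrable_oneDsqrV.
  - apply: aeW => x k _; rewrite patchE; case: ifPn => _ /=.
      by rewrite lee_fin.
    by rewrite normr0 lee_fin (le_trans _ (bG x)).
  - by under eq_fun do rewrite -integral_mkcond.
by apply: cvg_unique domcvg lim0.
Unshelve. all: by end_near.
Qed.

Lemma rV_cons_line0 n (h a : R) (v : 'rV[R]_n) :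
  h *: delta_mx ord0 ord0 + rV_cons (a, v) = rV_cons (h *: (1 : R) + a : R, v).
Proof.
apply/rowP => i; rewrite !mxE.
case: unliftP => [j|] -> /=; first by rewrite mulr0 add0r.
by [].
Qed.

Lemma rV_cons_lineS n (j : 'I_n) (h a : R) (v : 'rV[R]_n) :
  h *: delta_mx ord0 (lift ord0 j) + rV_cons (a, v) =
  rV_cons (a, h *: delta_mx ord0 j + v).
Proof.
apply/rowP => i; rewrite !mxE; case: unliftP => [k|] -> /=.
  by rewrite !mxE (inj_eq lift_inj).
by rewrite mulr0 add0r.
Qed.

(** The fundamental theorem of calculus on the lines parallel to a coordinate
    axis, then Fubini's theorem. The measure on R^(n+1) splits off the first
    coordinate, hence the induction on [n]: the derivative is either along that
    coordinate or along one of the others. *)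
Lemma integral_partial0 n (j : 'I_n) (F G : 'rV[R]_n -> R) (K : R) :
  (forall x, is_derive x (delta_mx ord0 j) F (G x)) ->
  (forall x, continuous (fun h : R => G (h *: delta_mx ord0 j + x))) ->
  measurable_fun [set: 'rV[R]_n] G ->
  (forall x, `|F x| <= K * weight x) -> (forall x, `|G x| <= K * weight x) ->
  (\int[leb R n]_x (G x)%:E = 0)%E.
Proof.
elim: n j F G K => [[]//|n IH] j F G K dF cG mG bF bG.
have mGc : measurable_fun setT (EFin \o G) by exact/measurable_EFinP.
have iG : (leb R n.+1).-integrable setT (EFin \o G).
  apply: (le_integrable measurableT mGc _ (integrable_weight n.+1 K)) => x _ /=.
  by rewrite lee_fin (le_trans (bG x))// ler_norm.
have mGp : measurable_fun setT ((EFin \o G) \o @rV_cons R n).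
  by apply: measurableT_comp => //; exact: measurable_rV_cons.
have iGp : (@lebesgue_measure R \x leb R n)%E.-integrable setT
    ((EFin \o G) \o @rV_cons R n).
  apply/integrableP; split => //.
  move/integrableP : iG => [_]; apply: le_lt_trans.
  rewrite le_eqVlt; apply/orP; left; apply/eqP/esym.
  apply: (ge0_integral_pushforward (@measurable_rV_cons R n)) => //.
  by apply: measurableT_comp.
transitivity (\int[(@lebesgue_measure R \x leb R n)%E]_p
    ((EFin \o G) \o @rV_cons R n) p)%E.
  exact: (integral_pushforward (@measurable_rV_cons R n) mGc iGp measurableT).
have [jE|[j' jE]] : j = ord0 \/ exists j', j = lift ord0 j'.
  by case: (unliftP ord0 j) => [j'|] ->; [right; exists j'|left].
  subst j; rewrite -integral21_prod_meas1//; apply: integral0_eq => v _.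
  apply: (@integral_derive0 (fun a => F (rV_cons (a, v)))
    (fun a => G (rV_cons (a, v))) (K * weight v)) => [a|a|a|a].
  - apply: (is_derive_line _ _ _ _ _ _ _ _ (dF (rV_cons (a, v)))) => h.
    by rewrite rV_cons_line0.
  - have -> : (fun a => G (rV_cons (a, v))) =
        (fun h => G (h *: delta_mx ord0 ord0 + rV_cons (0, v))).
      apply/funext => h; rewrite rV_cons_line0 addr0; congr (G (rV_cons (_, _))).
      by rewrite /GRing.scale /= mulr1.
    exact: cG.
  - by rewrite mulrAC -mulrA -weight_rV_cons.
  - by rewrite mulrAC -mulrA -weight_rV_cons.
subst j; rewrite -integral12_prod_meas1//; apply: integral0_eq => a _.
apply: (IH j' (fun v => F (rV_cons (a, v))) _ (K * (1 + a ^+ 2)^-1)) => [v|v||v|v].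
- apply: (is_derive_line _ _ _ _ _ _ _ _ (dF (rV_cons (a, v)))) => h.
  by rewrite rV_cons_lineS.
- have -> : (fun h => G (rV_cons (a, h *: delta_mx ord0 j' + v))) =
      (fun h => G (h *: delta_mx ord0 (lift ord0 j') + rV_cons (a, v))).
    by apply/funext => h; rewrite rV_cons_lineS.
  exact: cG.
- by apply: (measurable_fun_pair2 (f := G \o @rV_cons R n)); apply: measurableT_comp mG _;
  exact: measurable_rV_cons.
- by rewrite -mulrA -weight_rV_cons.
- by rewrite -mulrA -weight_rV_cons.
Qed.

End vanishing_integral.

(** * Continuous functions are measurable for the coordinate sigma-algebra *)

Section continuous_measurable.
Context {R : realType}.

Lemma measurable_countable_comp {d} {T : measurableType d} {U : countType}
    (h : T -> U) (g : U -> R) :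
  (forall u, measurable (h @^-1` [set u])) -> measurable_fun [set: T] (g \o h).
Proof.
move=> mh _ Y mY; rewrite setTI.
rewrite (_ : _ @^-1` _ = \bigcup_u (h @^-1` [set u] `&` [set _ | Y (g u)])).
  apply: countable_bigcupT_measurable; first exact: countableP.
  move=> u; have [Yu|Yu] := pselect (Y (g u)).
    rewrite (_ : [set _ | _] = setT) ?setIT//.
    by apply/seteqP; split.
  rewrite (_ : [set _ | _] = set0) ?setI0//.
  by apply/seteqP; split.
apply/seteqP; split=> [x Yx|x [u _ [/= <-]]]//.
by exists (h x).
Qed.

Definition grid_index {n} (k : nat) (x : 'rV[R]_n) : 'rV[int]_n :=
  \row_j Num.floor (k.+1%:R * x ord0 j).

Definition grid_point {n} (k : nat) (z : 'rV[int]_n) : 'rV[R]_n :=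
  \row_j ((z ord0 j)%:~R / k.+1%:R).

Lemma measurable_grid_index n k (z : 'rV[int]_n) :
  measurable (grid_index k @^-1` [set z]).
Proof.
rewrite (_ : _ @^-1` _ = \bigcap_(j in [set: 'I_n]) (@rV_coord R n j @^-1`
    ((fun a => k.+1%:R * a) @^-1` `[(z ord0 j)%:~R, (z ord0 j + 1)%:~R[))).
  apply: fin_bigcap_measurable => // j _.
  rewrite -[X in measurable X]setTI; apply: measurable_rV_coord => //.
  rewrite -[X in measurable X]setTI; apply: measurable_funM => //.
apply/seteqP; split=> [x /= <- j _ /=|x /= H].
  by rewrite in_itv /= mxE; exact: floor_itv.
apply/rowP => j; rewrite mxE; apply: floor_def.
by have := H j I; rewrite /= in_itv.
Qed.

Lemma cvg_grid n (x : 'rV[R]_n) :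
  grid_point k (grid_index k x) @[k --> \oo] --> x.
Proof.
apply/cvg_ballP => e e0; near=> k; split=> // i j.
rewrite !mxE !ord1 /ball /=.
have k0 : 0 < k.+1%:R :> R by [].
have /andP[h1 h2] := floor_itv (k.+1%:R * x ord0 j).
have kx : x ord0 j = (k.+1%:R * x ord0 j) / k.+1%:R.
  by rewrite mulrAC divff ?mul1r// gt_eqF.
rewrite {1}kx -mulrBl normrM ger0_norm ?subr_ge0//.
rewrite [X in _ * X]ger0_norm ?invr_ge0 ?ltW// ltr_pdivrMr//.
rewrite (@lt_trans _ _ 1)//.
  by rewrite ltrBlDr; move: h2; rewrite intrD addrC.
rewrite mulrC -ltr_pdivrMr// (@lt_le_trans _ _ k%:R) ?ler_nat//.
  near: k; exact: nbhs_infty_gtr.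
Unshelve. all: by end_near. Qed.

(** The topology of the norm and the sigma-algebra of the coordinates are
    compared by sampling [f] on finer and finer grids: a sampled function
    only takes countably many values, on cells that are boxes. *)
Lemma continuous_measurable_rV2 m n (f : 'rV[R]_m * 'rV[R]_n -> R) :
  continuous f -> measurable_fun [set: 'rV[R]_m * 'rV[R]_n] f.
Proof.
move=> cf.
apply: (@measurable_fun_cvg _ _ _ _ (fun k p =>
  f (grid_point k (grid_index k p.1), grid_point k (grid_index k p.2)))).
  move=> k; apply: (@measurable_countable_comp _ _
    ('rV[int]_m * 'rV[int]_n)%type (fun p => (grid_index k p.1, grid_index k p.2))
    (fun z => f (grid_point k z.1, grid_point k z.2))) => -[z1 z2].
  rewrite (_ : _ @^-1` _ = (grid_index k @^-1` [set z1]) `*`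
      (grid_index k @^-1` [set z2])).
    by apply: measurableX; exact: measurable_grid_index.
  by apply/seteqP; split => -[x y] /= [-> ->].
move=> [x y] _ /=.
pose g k := (grid_point k (grid_index k x), grid_point k (grid_index k y)).
have cg : g k @[k --> \oo] --> (x, y) by exact: (cvg_pair (cvg_grid _ x) (cvg_grid _ y)).
exact: (cvg_comp g f cg (cf (x, y))).
Qed.

End continuous_measurable.

(** * Exponential decay from factorial bounds *)

Section exponential_decay.
Context {R : realType}.
Implicit Types mu C y g M : R.

Lemma sum_half_le N : \sum_(0 <= k < N) (2^-1 ^+ k : R) <= 2.
Proof.
suff -> : \sum_(0 <= k < N) (2^-1 ^+ k : R) = 2 - 2 * 2^-1 ^+ N.
  by rewrite gerBl mulr_ge0// exprn_ge0// invr_ge0.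
elim: N => [|N IH]; first by rewrite big_geq// expr0 mulr1 subrr.
by rewrite big_nat_recr//= IH exprS; field.
Qed.

(** The [mu]-th roots of the bounds [y^k g <= M C^k k!^mu] bound all terms of the
    exponential series of [(y/C)^(1/mu)] by one constant; halving the argument
    makes the series of these bounds converge. *)
Lemma factorial_decay mu C y g M : 0 < mu -> 0 < C -> 0 <= y -> 0 <= g ->
  (forall k, y ^+ k * g <= M * C ^+ k * k`!%:R `^ mu) ->
  g <= 2 `^ mu * M * expR (- (mu / 2 * (y / C) `^ mu^-1)).
Proof.
move=> mu0 C0 y0; rewrite le_eqVlt => /predU1P[<-|g0] H.
  have M0 : 0 <= M by have := H 0; rewrite mulr0 expr0 fact0 powR1 !mulr1.
  by rewrite !mulr_ge0 ?powR_ge0 ?expR_ge0.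
have M0 : 0 < M.
  rewrite (lt_le_trans g0)//.
  by have := H 0; rewrite !expr0 mul1r fact0 powR1 !mulr1.
pose z := (y / C) `^ mu^-1; pose h := (g / M) `^ mu^-1.
have muV0 : 0 <= mu^-1 by rewrite invr_ge0 ltW.
have z0 : 0 <= z by exact: powR_ge0.
have h0 : 0 < h by rewrite powR_gt0// divr_gt0.
have yC0 : 0 <= y / C by rewrite divr_ge0// ltW.
have gM0 : 0 <= g / M by rewrite divr_ge0 ?ltW.
have term k : h * z ^+ k <= k`!%:R.
  have : (g / M * (y / C) ^+ k) `^ mu^-1 <= (k`!%:R `^ mu) `^ mu^-1.
    rewrite ge0_ler_powR ?nnegrE ?powR_ge0//.
      by rewrite mulr_ge0 ?exprn_ge0.
    rewrite expr_div_n mulf_div ler_pdivrMr ?mulr_gt0 ?exprn_gt0//.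
    by rewrite mulrC [leRHS]mulrC; exact: H.
  have -> : (g / M * (y / C) ^+ k) `^ mu^-1 = h * z ^+ k.
    rewrite powRM ?exprn_ge0//; congr (_ * _).
    by rewrite -(powR_mulrn k yC0) -powRrM [k%:R * _]mulrC powRrM powR_mulrn.
  by move=> /le_trans; apply; rewrite -powRrM divff ?gt_eqF// powRr1.
have expz : expR (z / 2) <= 2 / h.
  apply: limr_le; first exact: is_cvg_series_exp_coeff.
  apply: nearW => N; rewrite ler_pdivlMr// mulrC /series /= mulr_sumr.
  rewrite (le_trans _ (sum_half_le N))//; apply: ler_sum => k _.
  rewrite /exp_coeff /= mulrA ler_pdivrMr ?ltr0n ?fact_gt0//.
  by rewrite expr_div_n exprVn mulrA mulrC ler_wpM2l// invr_ge0 exprn_ge0.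
have : expR (mu / 2 * z) <= 2 `^ mu * M / g.
  rewrite (_ : mu / 2 * z = (z / 2) * mu); last by field.
  have h2 : 0 <= 2 / h by rewrite divr_ge0// ltW.
  have hmu : h `^ mu = g / M.
    by rewrite /h -powRrM mulVf ?gt_eqF// powRr1.
  have hV : h^-1 `^ mu = M / g.
    by rewrite -powR_inv1 ?(ltW h0)// -powRrM mulrC powRrM hmu powR_inv1// invf_div.
  rewrite expRM -mulrA -hV -powRM ?invr_ge0 ?(ltW h0)//.
  by apply: (ge0_ler_powR (ltW mu0)); rewrite ?nnegrE ?expR_ge0.
rewrite expRN ler_pdivlMr// -ler_pdivlMl ?expR_gt0// mulrC.
by rewrite ler_pdivlMr ?expR_gt0 // mulrC.
Qed.

Lemma coord_le_enorm {n} (x : 'rV[R]_n) j : `|x ord0 j| <= enorm x.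
Proof.
rewrite -sqrtr_sqr ler_wsqrtr// /dotr (bigD1 j)//= expr2 lerDl.
by apply: sumr_ge0 => i _; rewrite -expr2 sqr_ge0.
Qed.

Lemma enorm_ge0 {n} (x : 'rV[R]_n) : 0 <= enorm x.
Proof. exact: sqrtr_ge0. Qed.

Lemma enorm_le {n} (x : 'rV[R]_n) y : 0 <= y ->
  (forall j, `|x ord0 j| <= y) -> enorm x <= n%:R * y.
Proof.
move=> y0 xy; rewrite -[leRHS]ger0_norm ?mulr_ge0// -[leRHS]sqrtr_sqr.
rewrite ler_wsqrtr// /dotr (@le_trans _ _ (\sum_(j < n) y ^+ 2))//.
  apply: ler_sum => j _; rewrite -expr2 -[x _ _ ^+ 2]ger0_norm ?sqr_ge0// normrX.
  by rewrite lerXn2r ?nnegrE.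
rewrite sumr_const card_ord -[leLHS]mulr_natl exprMn ler_wpM2r ?sqr_ge0// -natrX ler_nat.
by case: (n) => // k; rewrite expnS expn1 leq_pmulr.
Qed.

(** [factorial_decay] gives the rate [mu / 2] in [(y / C)^(1/mu)], where [y] is the
    largest coordinate; the factor [n + 1] pays for replacing [y] by the Euclidean
    norm, and keeps the rate positive in dimension 0. *)
Definition decay_rate (n : nat) mu C : R :=
  mu / 2 * ((n.+1%:R * C)^-1) `^ mu^-1.

Lemma decay_rate_gt0 n mu C : 0 < mu -> 0 < C -> 0 < decay_rate n mu C.
Proof.
by move=> mu0 C0; rewrite mulr_gt0 ?divr_gt0// powR_gt0// invr_gt0 mulr_gt0.
Qed.

Lemma exp_decay {n} mu C (x : 'rV[R]_n) g M : 0 < mu -> 0 < C -> 0 <= g -> g <= M ->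
  (forall j k, `|x ord0 j| ^+ k * g <= M * C ^+ k * k`!%:R `^ mu) ->
  g <= 2 `^ mu * M * expR (- (decay_rate n mu C * enorm x `^ mu^-1)).
Proof.
move=> mu0 C0 g0 gM H.
have [n0|n0] := posnP n.
  subst n; rewrite /enorm /dotr big_ord0 sqrtr0 powR0 ?invr_eq0 ?gt_eqF//.
  rewrite mulr0 oppr0 expR0 mulr1 (le_trans gM)// ler_peMl//.
    exact: le_trans gM.
  by rewrite -[leLHS](powRr0 2) ler_powR ?ler1n// ltW.
(* The coordinate of largest modulus controls the norm. *)
pose j := [arg max_(j > Ordinal n0) `|x ord0 j|]%O.
have jmax i : `|x ord0 i| <= `|x ord0 j|.
  by rewrite /j; case: arg_maxP => // k _ /(_ i isT).
have xj0 : 0 <= `|x ord0 j| by [].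
rewrite (le_trans (factorial_decay mu C _ g M mu0 C0 xj0 g0 (H j)))//.
rewrite ler_wpM2l ?mulr_ge0 ?powR_ge0 ?(le_trans g0)//.
rewrite ler_expR lerN2 /decay_rate -[leLHS]mulrA ler_wpM2l ?divr_ge0 ?(ltW mu0)//.
have nC0 : 0 < n.+1%:R * C by rewrite mulr_gt0.
rewrite -powRM ?enorm_ge0 ?invr_ge0 ?(ltW nC0)//.
have muV0 : 0 <= mu^-1 by rewrite invr_ge0 ltW.
apply: (ge0_ler_powR muV0); rewrite ?nnegrE.
- by rewrite mulr_ge0 ?enorm_ge0// invr_ge0 ltW.
- by rewrite divr_ge0// ltW.
rewrite ler_pdivrMl//.
rewrite (_ : n.+1%:R * C * (`|x ord0 j| / C) = n.+1%:R * `|x ord0 j|); last first.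
  by field; rewrite gt_eqF.
rewrite (le_trans (enorm_le x _ xj0 jmax))//.
by rewrite ler_wpM2r// ler_nat.
Qed.

(** With [s = |x|^(1/mu)] the inverse of the weight is at most polynomial in [s],
    and any exponential beats it. *)
Lemma exp_le_weight n mu (b : R) : 0 < mu -> 0 < b ->
  exists2 K : R, 0 < K & forall x : 'rV[R]_n,
    expR (- (b * enorm x `^ mu^-1)) <= K * weight x.
Proof.
move=> mu0 b0.
(* [N] is chosen for [s^(2 mu) <= (1 + s)^N], and [d] is small enough for
   [(1 + s)^P <= d^(-P) exp (d P s)] to be absorbed by [exp (b s)]. *)
pose N := Num.bound (2 * mu); pose P := (N * n)%N.
pose d := Num.min 1 (b / P.+1%:R).
have d0 : 0 < d by rewrite lt_min ltr01 divr_gt0.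
have d1 : d <= 1 by rewrite ge_min lexx.
have dP : d * P%:R <= b.
  rewrite (@le_trans _ _ (b / P.+1%:R * P%:R))//.
    by rewrite ler_wpM2r// ge_min lexx orbT.
  by rewrite mulrAC ler_pdivrMr// ler_wpM2l ?(ltW b0)// ler_nat.
exists (2 ^+ n * d^-1 ^+ P); first by rewrite mulr_gt0 ?exprn_gt0 ?invr_gt0.
move=> x; set e := enorm x; pose s := e `^ mu^-1.
have e0 : 0 <= e by exact: enorm_ge0.
have s0 : 0 <= s by exact: powR_ge0.
have s1 : 1 <= 1 + s by rewrite lerDl.
have eE : e ^+ 2 <= (1 + s) ^+ N.
  have -> : e ^+ 2 = s `^ (mu * 2).
    by rewrite /s -powRrM mulKf ?gt_eqF// powR_mulrn.
  rewrite -powR_mulrn ?(le_trans ler01)//.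
  rewrite (@le_trans _ _ ((1 + s) `^ (mu * 2)))//.
    by rewrite ge0_ler_powR ?nnegrE ?mulr_ge0 ?(ltW mu0) ?lerDr// (le_trans ler01).
  by rewrite ler_powR// mulrC ltW// archi_boundP// mulr_ge0// ltW.
have prod_le : \prod_j (1 + x ord0 j ^+ 2) <= 2 ^+ n * (1 + s) ^+ P.
  rewrite exprM -exprMn -[X in _ ^+ X]card_ord -prodr_const.
  apply: ler_prod => j _; rewrite addr_ge0 ?sqr_ge0//=.
  rewrite mulr_natl mulr2n lerD ?exprn_ege1// (le_trans _ eE)//.
  by rewrite -[leLHS]ger0_norm ?sqr_ge0// normrX lerXn2r ?nnegrE// coord_le_enorm.
have pow_le : (1 + s) ^+ P <= d^-1 ^+ P * expR (b * s).
  have q0 : 0 <= d^-1 * expR (d * s) by rewrite mulr_ge0 ?expR_ge0// invr_ge0 ltW.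
  rewrite (@le_trans _ _ ((d^-1 * expR (d * s)) ^+ P))//.
    rewrite lerXn2r ?nnegrE ?(le_trans ler01 s1)//.
    rewrite mulrC ler_pdivlMr// (le_trans _ (expR_ge1Dx _))//.
    by rewrite mulrDl mul1r lerD// mulrC.
  rewrite exprMn -expRM_natr ler_wpM2l ?exprn_ge0 ?invr_ge0 ?(ltW d0)//.
  by rewrite ler_expR mulrAC ler_wpM2r.
have p0 : 0 < \prod_j (1 + x ord0 j ^+ 2).
  by apply: prodr_gt0 => j _; rewrite ltr_pwDl// sqr_ge0.
rewrite expRN /weight prodfV ler_pdivlMr// mulrC ler_pdivrMr ?expR_gt0//.
by rewrite (le_trans prod_le)// -mulrA ler_wpM2l ?exprn_ge0.
Qed.

End exponential_decay.

(** * Smooth functions and iterated partial derivatives *)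

Lemma foldr_iter1 {I : eqType} {X : Type} (D : I -> X -> X) (j : I) (k : nat)
    (s : seq I) (x : X) : uniq s ->
  foldr (fun i y => iter (if i == j then k else 0%N) (D i) y) x s =
  if j \in s then iter k (D j) x else x.
Proof.
elim: s => //= i s IH /andP[iNs us]; rewrite IH// inE eq_sym.
by case: eqVneq => [->|] //=; rewrite (negbTE iNs).
Qed.

Lemma is_derive_lin2 {R : realType} {V : normedModType R} (p v : V)
    (f g : V -> R) (df dg a b : R) : is_derive p v f df -> is_derive p v g dg ->
  is_derive p v (fun q => a * f q + b * g q) (a * df + b * dg).
Proof.
by move=> hf hg; exact: (is_deriveD (is_deriveZ a hf) (is_deriveZ b hg)).
Qed.

Lemma cderive_linear {R : realType} {V : normedModType R} (v : V)
    (f g : V -> R[i]) (a b : R[i]) : cderivable v f -> cderivable v g ->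
  cderivable v (fun p => a * f p + b * g p) /\
  cderive v (fun p => a * f p + b * g p) =
    (fun p => a * cderive v f p + b * cderive v g p).
Proof.
move=> df dg.
have d1 p : is_derive p v (fun q => complex.Re (a * f q + b * g q))
    (complex.Re (a * cderive v f p + b * cderive v g p)).
  have [/derivableP fr /derivableP fi] := df p.
  have [/derivableP gr /derivableP gi] := dg p.
  under eq_fun do rewrite ReD !ReM -!mulNr.
  rewrite ReD !ReM -!mulNr /=.
  exact: (is_deriveD (is_derive_lin2 _ _ _ _ _ _ _ _ fr fi)
    (is_derive_lin2 _ _ _ _ _ _ _ _ gr gi)).
have d2 p : is_derive p v (fun q => complex.Im (a * f q + b * g q))
    (complex.Im (a * cderive v f p + b * cderive v g p)).
  have [/derivableP fr /derivableP fi] := df p.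
  have [/derivableP gr /derivableP gi] := dg p.
  under eq_fun do rewrite ImD !ImM.
  rewrite ImD !ImM /=.
  exact: (is_deriveD (is_derive_lin2 _ _ _ _ _ _ _ _ fi fr)
    (is_derive_lin2 _ _ _ _ _ _ _ _ gi gr)).
split; first by move=> p; split; [apply: (@ex_derive _ _ _ _ _ _ _ (d1 p))|
  apply: (@ex_derive _ _ _ _ _ _ _ (d2 p))].
apply/funext => p; rewrite [RHS]complex_eta /cderive.
by rewrite (@derive_val _ _ _ _ _ _ _ (d1 p)) (@derive_val _ _ _ _ _ _ _ (d2 p)).
Qed.

Section smooth_functions.
Context {R : realType} {m n : nat}.
Local Notation E := ('rV[R]_m * 'rV[R]_n)%type.
Implicit Types (f g : E -> R[i]).

Lemma smooth_ccontinuous f : smooth f -> ccontinuous f.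
Proof. by move=> /(_ 0%N) []. Qed.

Lemma smooth_cderivable f k : smooth f -> cderivable (dir k) f.
Proof. by move=> /(_ 1%N) [_ /(_ k) []]. Qed.

Lemma smooth_cderive f k : smooth f -> smooth (cderive (dir k) f).
Proof. by move=> sf N; have [_ /(_ k) []] := sf N.+1. Qed.

Lemma smooth_iter_cderive f k N : smooth f -> smooth (iter N (cderive (dir k)) f).
Proof. by move=> sf; elim: N => //= N IH; exact: smooth_cderive. Qed.

Lemma smooth_cmeasurable f : smooth f -> cmeasurable f.
Proof.
by move=> /smooth_ccontinuous [f1 f2]; split; exact: continuous_measurable_rV2.
Qed.

Lemma ccontinuousM {T : topologicalType} (f g : T -> R[i]) :
  ccontinuous f -> ccontinuous g -> ccontinuous (fun x => f x * g x).
Proof.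
move=> [f1 f2] [g1 g2]; split.
  under eq_fun do rewrite ReM.
  by move=> x; apply: cvgB; apply: cvgM; [exact: f1|exact: g1|exact: f2|exact: g2].
under eq_fun do rewrite ImM.
by move=> x; apply: cvgD; apply: cvgM; [exact: f1|exact: g2|exact: f2|exact: g1].
Qed.

Lemma ccontinuousD {T : topologicalType} (f g : T -> R[i]) :
  ccontinuous f -> ccontinuous g -> ccontinuous (fun x => f x + g x).
Proof.
move=> [f1 f2] [g1 g2]; split.
  by under eq_fun do rewrite ReD; move=> x; apply: cvgD; [exact: f1|exact: g1].
by under eq_fun do rewrite ImD; move=> x; apply: cvgD; [exact: f2|exact: g2].
Qed.

Lemma ccontinuous_cst {T : topologicalType} (c : R[i]) :
  ccontinuous (fun _ : T => c).
Proof. by split=> x; exact: cvg_cst. Qed.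

Lemma smooth_linear f g (a b : R[i]) : smooth f -> smooth g ->
  smooth (fun p => a * f p + b * g p).
Proof.
move=> sf sg k; move: (sf k) (sg k) => {sf sg}.
elim: k f g => [|k IH] f g [cf df] [cg dg]; split => //;
  try by apply: ccontinuousD; apply: ccontinuousM => //; exact: ccontinuous_cst.
move=> i; have [df1 df2] := df i; have [dg1 dg2] := dg i.
have [d1 ->] := cderive_linear (dir i) f g a b df1 dg1.
by split => //; exact: IH.
Qed.

Lemma iter_cderive_linear k N f g (a b : R[i]) : smooth f -> smooth g ->
  iter N (cderive (dir k)) (fun p => a * f p + b * g p) =
  (fun p => a * iter N (cderive (dir k)) f p + b * iter N (cderive (dir k)) g p).
Proof.
move=> sf sg; elim: N => //= N ->.
by have [_ ->] := cderive_linear (dir k) _ _ a b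
  (smooth_cderivable _ k (smooth_iter_cderive f k N sf))
  (smooth_cderivable _ k (smooth_iter_cderive g k N sg)).
Qed.

Section multi.
Context {r : nat} (e : 'I_r -> 'I_m + 'I_n).
Local Notation D := (multi_derive (fun i => @dir R m n (e i))).

Lemma smooth_multi_derive c f : smooth f -> smooth (D c f).
Proof.
rewrite /multi_derive => sf; elim: (enum _) => //= i s IH.
exact: smooth_iter_cderive.
Qed.

Lemma multi_derive_linear c f g (a b : R[i]) : smooth f -> smooth g ->
  D c (fun p => a * f p + b * g p) = (fun p => a * D c f p + b * D c g p).
Proof.
move=> sf sg; rewrite /multi_derive.
have sm (h : E -> R[i]) s : smooth h ->
    smooth (foldr (fun i h => iter (c i) (cderive (dir (e i))) h) h s).
  by move=> sh; elim: s => //= i s IH; exact: smooth_iter_cderive.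
elim: (enum _) => //= i s ->; rewrite iter_cderive_linear//; exact: sm.
Qed.

End multi.

Lemma multi_derive0 {r} (e : 'I_r -> E) f : multi_derive e (fun=> 0%N) f = f.
Proof. by rewrite /multi_derive; elim: (enum _) => //= i s ->. Qed.

Lemma multi_derive1 {r} (e : 'I_r -> E) j k f :
  multi_derive e (fun i => if i == j then k else 0%N) f = iter k (cderive (e j)) f.
Proof. by rewrite /multi_derive foldr_iter1 ?enum_uniq// mem_enum. Qed.

End smooth_functions.

Section multi_indices.
Context {R : realType} {r : nat}.

Lemma mfact_gt0 (a : 'I_r -> nat) : 0 < mfact a :> R.
Proof. by apply: prodr_gt0 => i _; rewrite ltr0n fact_gt0. Qed.

Lemma mlength0 : mlength (fun _ : 'I_r => 0%N) = 0%N.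
Proof. by rewrite /mlength big1. Qed.

Lemma mlength1 (j : 'I_r) k : mlength (fun i => if i == j then k else 0%N) = k.
Proof. by rewrite /mlength -big_mkcond big_pred1_eq. Qed.

Lemma mfact0 : mfact (fun _ : 'I_r => 0%N) = 1 :> R.
Proof. by rewrite /mfact big1. Qed.

Lemma mfact1 (j : 'I_r) k : mfact (fun i => if i == j then k else 0%N) = k`!%:R :> R.
Proof.
rewrite /mfact (bigD1 j)//= eqxx big1 ?mulr1// => i /negbTE ->.
by rewrite fact0.
Qed.

Lemma mpow0 (x : 'rV[R]_r) : mpow x (fun=> 0%N) = 1.
Proof. by rewrite /mpow big1. Qed.

Lemma mpow1 (x : 'rV[R]_r) (j : 'I_r) k :
  mpow x (fun i => if i == j then k else 0%N) = x ord0 j ^+ k.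
Proof.
by rewrite /mpow (bigD1 j)//= eqxx big1 ?mulr1// => i /negbTE ->.
Qed.

End multi_indices.

(** * Gelfand-Shilov seminorms and their duals *)

Section gelfand_shilov_spaces.
Context {R : realType} {m n : nat}.
Local Notation E := ('rV[R]_m * 'rV[R]_n)%type.
Implicit Types (f g : E -> R[i]) (sigma mu C r : R).

Local Notation partial beta gamma f :=
  (multi_derive (@dir_x R m n) beta (multi_derive (@dir_t R m n) gamma f)).

Lemma partial_linear beta gamma f g (a b : R[i]) : smooth f -> smooth g ->
  partial beta gamma (fun p => a * f p + b * g p) =
  (fun p => a * partial beta gamma f p + b * partial beta gamma g p).
Proof.
move=> sf sg; rewrite (multi_derive_linear inl)//.
by rewrite (multi_derive_linear inr)//; exact: (smooth_multi_derive inl).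
Qed.

Lemma GS_norm_leP sigma mu C f r : 0 < C ->
  (GS_norm sigma mu C f <= r%:E)%E <->
  forall alpha beta gamma p,
    Normc.normc ((mpow p.2 alpha)%:C * partial beta gamma f p) <=
    C ^+ (mlength alpha + mlength beta + mlength gamma) * mfact gamma `^ sigma *
    (mfact alpha * mfact beta) `^ mu * r.
Proof.
move=> C0.
have eq alpha beta gamma p :
    (C ^- (mlength alpha + mlength beta + mlength gamma)
     * mfact gamma `^ (- sigma) * (mfact alpha * mfact beta) `^ (- mu)
     * Normc.normc ((mpow p.2 alpha)%:C * partial beta gamma f p) <= r) =
    (Normc.normc ((mpow p.2 alpha)%:C * partial beta gamma f p) <=
    C ^+ (mlength alpha + mlength beta + mlength gamma) * mfact gamma `^ sigma *
    (mfact alpha * mfact beta) `^ mu * r).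
  rewrite !powRN -!invfM ler_pdivrMl//.
  by rewrite !mulr_gt0 ?exprn_gt0 ?powR_gt0 ?mulr_gt0 ?mfact_gt0.
split=> [fr alpha beta gamma p|H].
  rewrite -eq -lee_fin (le_trans _ fr)//; apply: ereal_sup_ubound.
  by exists alpha, beta, gamma, p.
apply: ge_ereal_sup => _ [alpha [beta [gamma [p ->]]]].
by rewrite lee_fin eq.
Qed.

Lemma lty_le_real (x : \bar R) : (x < +oo)%E -> exists2 r : R, 0 <= r & (x <= r%:E)%E.
Proof.
case: x => [x _|//|_]; last by exists 0; rewrite ?leNye.
by exists `|x| => //; rewrite lee_fin ler_norm.
Qed.

Lemma GS_norm_mono sigma mu C C' f r : 0 < C -> C <= C' -> 0 <= r ->
  (GS_norm sigma mu C f <= r%:E)%E -> (GS_norm sigma mu C' f <= r%:E)%E.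
Proof.
move=> C0 CC' r0 /(GS_norm_leP _ _ _ _ _ C0) H.
apply/GS_norm_leP; first exact: lt_le_trans CC'.
move=> alpha beta gamma p; apply: (le_trans (H alpha beta gamma p)).
rewrite ler_wpM2r// ler_wpM2r ?powR_ge0// ler_wpM2r ?powR_ge0//.
by rewrite lerXn2r// nnegrE ltW// (lt_le_trans C0).
Qed.

Lemma GS_linear sigma mu f g (a b : R[i]) :
  GS m n sigma mu f -> GS m n sigma mu g ->
  GS m n sigma mu (fun p => a * f p + b * g p).
Proof.
move=> [C1 /= C10 [sf pf /lty_le_real [r1 r10 nf]]].
move=> [C2 /= C20 [sg pg /lty_le_real [r2 r20 ng]]].
pose C := Num.max C1 C2.
have C0 : 0 < C by rewrite lt_max C10.
have {}nf : (GS_norm sigma mu C f <= r1%:E)%E.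
  by apply: GS_norm_mono nf; rewrite // le_max lexx.
have {}ng : (GS_norm sigma mu C g <= r2%:E)%E.
  by apply: GS_norm_mono ng; rewrite // le_max lexx orbT.
exists C => //; split; first exact: smooth_linear.
  by move=> i t x; rewrite pf pg.
apply: (@le_lt_trans _ _ (Normc.normc a * r1 + Normc.normc b * r2)%:E); last first.
  exact: ltry.
apply/GS_norm_leP => // alpha beta gamma p; rewrite partial_linear//.
move/(GS_norm_leP _ _ _ _ _ C0)/(_ alpha beta gamma p) : nf.
move/(GS_norm_leP _ _ _ _ _ C0)/(_ alpha beta gamma p) : ng.
set B := C ^+ _ * _ * _; move=> ng nf.
rewrite mulrDr [_ * (a * _)]mulrCA [_ * (b * _)]mulrCA.
rewrite (le_trans (le_normcD _ _))// [leRHS]mulrDr !Normc.normcM.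
by rewrite lerD// [leRHS]mulrCA ler_wpM2l ?normc_ge0// -Normc.normcM.
Qed.

(** The seminorms with [alpha] concentrated on one coordinate already force
    exponential decay, with the same rate for all derivatives. *)
Lemma GS_partial_decay sigma mu C f r : 0 < mu -> 0 < C ->
  (GS_norm sigma mu C f <= r%:E)%E -> forall beta gamma t x,
  Normc.normc (partial beta gamma f (t, x)) <=
  2 `^ mu * (C ^+ (mlength beta + mlength gamma) * mfact gamma `^ sigma *
             mfact beta `^ mu * r) *
  expR (- (decay_rate n mu C * enorm x `^ mu^-1)).
Proof.
move=> mu0 C0 /(GS_norm_leP _ _ _ _ _ C0) H beta gamma t x.
apply: exp_decay => //; first exact: normc_ge0.
  have := H (fun=> 0%N) beta gamma (t, x).
  by rewrite mpow0 mul1r mlength0 mfact0 mul1r add0n.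
move=> j k; have := H (fun i => if i == j then k else 0%N) beta gamma (t, x).
rewrite mpow1 mlength1 mfact1 Normc.normcM normc_real normrX => /le_trans; apply.
rewrite powRM ?ler0n ?(ltW (mfact_gt0 _))// -addnA exprD le_eqVlt.
by apply/orP; left; apply/eqP; ring.
Qed.

Lemma GS_decay sigma mu C f r : 0 < mu -> 0 < C ->
  (GS_norm sigma mu C f <= r%:E)%E -> forall t x,
  Normc.normc (f (t, x)) <=
  2 `^ mu * r * expR (- (decay_rate n mu C * enorm x `^ mu^-1)).
Proof.
move=> mu0 C0 fr t x.
have := GS_partial_decay _ _ _ _ _ mu0 C0 fr (fun=> 0%N) (fun=> 0%N) t x.
by rewrite !multi_derive0 !mlength0 !mfact0 !powR1 expr0 !mul1r.
Qed.

Lemma GS_cderive_decay sigma mu C f r : 0 < mu -> 0 < C ->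
  (GS_norm sigma mu C f <= r%:E)%E -> forall j k t x,
  Normc.normc (iter k (cderive (dir_x j)) f (t, x)) <=
  2 `^ mu * (C ^+ k * k`!%:R `^ mu * r) *
  expR (- (decay_rate n mu C * enorm x `^ mu^-1)).
Proof.
move=> mu0 C0 fr j k t x.
have := GS_partial_decay _ _ _ _ _ mu0 C0 fr
  (fun i => if i == j then k else 0%N) (fun=> 0%N) t x.
by rewrite multi_derive0 multi_derive1 mlength0 mlength1 mfact0 mfact1
  powR1 addn0 mulr1.
Qed.

(** A linear functional is continuous for the inductive limit topology as soon
    as it is bounded on each step, since its sublevel sets are then absolutely
    convex neighbourhoods of the origin. *)
Lemma GS_dual_bounded sigma mu (T : (E -> R[i]) -> R[i]) :
  (forall f g (a b : R[i]), GS m n sigma mu f -> GS m n sigma mu g ->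
    T (fun p => a * f p + b * g p) = a * T f + b * T g) ->
  (forall C, 0 < C -> exists2 K : R, 0 <= K & forall f r,
    GS_C sigma mu C f -> (GS_norm sigma mu C f <= r%:E)%E ->
    Normc.normc (T f) <= K * r) ->
  GS_dual m n sigma mu T.
Proof.
move=> linT bndT; split.
  move=> f g a Gf Gg; have := linT f g a 1 Gf Gg; rewrite mul1r => <-.
  by congr T; apply/funext => p; rewrite mul1r.
move=> phi Gphi e e0; exists [set f | GS m n sigma mu f /\ Normc.normc (T f) < e].
  split.
  - by move=> f [].
  - move=> f g a b [Gf Tf] [Gg Tg] ab1; split; first exact: GS_linear.
    rewrite linT// (le_lt_trans (le_normcD _ _))// !Normc.normcM.
    pose M := Num.max (Normc.normc (T f)) (Normc.normc (T g)).
    rewrite (@le_lt_trans _ _ M)//; last by rewrite gt_max Tf.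
    have M0 : 0 <= M by rewrite le_max normc_ge0.
    rewrite (@le_trans _ _ ((Normc.normc a + Normc.normc b) * M))//.
      by rewrite mulrDl lerD// ler_wpM2l ?normc_ge0// le_max lexx ?orbT.
    by rewrite -[leRHS]mul1r ler_wpM2r.
  - move=> C C0; have [K K0 HK] := bndT C C0.
    have K1 : 0 < K + 1 by rewrite ltr_wpDl.
    exists (e / (K + 1)) => [|f Cf fr]; first by rewrite divr_gt0.
    split; first by exists C.
    rewrite (le_lt_trans (HK f _ Cf (ltW fr)))// mulrCA gtr_pMr//.
    by rewrite ltr_pdivrMr// mul1r ltrDl.
move=> psi [Gpsi Tpsi].
have -> : (fun p => phi p + psi p) = (fun p => 1 * phi p + 1 * psi p).
  by apply/funext => p; rewrite !mul1r.
by rewrite /= linT// !mul1r addrC addKr.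
Qed.

End gelfand_shilov_spaces.

(** * Decay of the partial Fourier integral *)

Section fourier_decay.
Context {R : realType} {m n : nat}.
Local Notation E := ('rV[R]_m * 'rV[R]_n)%type.
Implicit Types (f g : E -> R[i]) (sigma mu C r : R).

Lemma dotr_line (j : 'I_n) (h : R) (x xi : 'rV[R]_n) :
  dotr (h *: delta_mx ord0 j + x) xi = h * xi ord0 j + dotr x xi.
Proof.
rewrite /dotr (bigD1 j)//= [in RHS](bigD1 j)//= !mxE !eqxx mulr1 mulrDl -addrA.
congr (_ + (_ + _)); apply: eq_bigr => i ij.
by rewrite !mxE (negbTE ij) andbF mulr0 add0r.
Qed.

Lemma dotrC (x y : 'rV[R]_n) : dotr x y = dotr y x.
Proof. by apply: eq_bigr => i _; rewrite mulrC. Qed.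

Lemma measurable_dotr : measurable_fun [set: 'rV[R]_n * 'rV[R]_n]
  (fun p => dotr p.1 p.2).
Proof.
have -> : (fun p : 'rV[R]_n * 'rV[R]_n => dotr p.1 p.2) =
    (fun p => \sum_(j <- enum 'I_n) p.1 ord0 j * p.2 ord0 j).
  by apply/funext => p; rewrite big_enum.
elim: (enum 'I_n) => [|j s IH].
  by under eq_fun do rewrite big_nil; exact: measurable_cst.
under eq_fun do rewrite big_cons; apply: measurable_funD => //.
apply: measurable_funM.
  exact: (measurableT_comp (@measurable_rV_coord R n j) measurable_fst).
exact: (measurableT_comp (@measurable_rV_coord R n j) measurable_snd).
Qed.

(** The integral occurring in [inv_fourier], up to its constant factor. *)
Definition wave_integral f (p : E) : R[i] :=
  cintegral (leb R n) setT (fun x => f (p.1, x) * expi (dotr x p.2)).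

Lemma cmeasurable_wave f : cmeasurable f ->
  cmeasurable (fun q : E * 'rV[R]_n => f (q.1.1, q.2) * expi (dotr q.2 q.1.2)).
Proof.
move=> mf; apply: cmeasurableM.
  apply: cmeasurable_comp mf; apply: measurable_fun_pair.
    exact: (measurableT_comp measurable_fst measurable_fst).
  exact: measurable_snd.
apply: cmeasurable_expi.
apply: (@measurableT_comp _ _ _ _ _ _ (fun p : 'rV[R]_n * 'rV[R]_n => dotr p.1 p.2)
  _ (fun q : E * 'rV[R]_n => (q.2, q.1.2))).
  exact: measurable_dotr.
apply: measurable_fun_pair; first exact: measurable_snd.
exact: (measurableT_comp measurable_snd measurable_fst).
Qed.

Lemma cmeasurable_wave_integral f : cmeasurable f -> cmeasurable (wave_integral f).
Proof.
move=> mf; exact: (cmeasurable_cintegral (leb R n) _ (cmeasurable_wave f mf)).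
Qed.

Lemma cmeasurable_wave_section f t xi : cmeasurable f ->
  cmeasurable (fun x => f (t, x) * expi (dotr x xi)).
Proof.
move=> mf; apply: (cmeasurable_comp (fun x => ((t, xi), x)) _ _ (cmeasurable_wave f mf)).
exact: pair1_measurable.
Qed.

Lemma cintegrable_wave f t xi K : cmeasurable f ->
  (forall x, Normc.normc (f (t, x)) <= K * weight x) ->
  cintegrable (leb R n) setT (fun x => f (t, x) * expi (dotr x xi)).
Proof.
move=> mf fK; apply: (cintegrable_le _ _ _ (fun x => K * weight x)) => //.
- exact: cmeasurable_wave_section.
- by move=> x _; rewrite Normc.normcM normc_expi mulr1.
- exact: integrable_weight.
Qed.

(** The product rule, for the real and imaginary parts of
    [(a + i b) exp (i (h s + c))]. *)
Lemma is_derive_wave (a b : R -> R) (da db c s : R) :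
  is_derive (0 : R) (1 : R) a da -> is_derive (0 : R) (1 : R) b db ->
  is_derive (0 : R) (1 : R) (fun h => a h * cos (h * s + c) - b h * sin (h * s + c))
    (da * cos c - db * sin c - s * (a 0 * sin c + b 0 * cos c)) /\
  is_derive (0 : R) (1 : R) (fun h => a h * sin (h * s + c) + b h * cos (h * s + c))
    (da * sin c + db * cos c + s * (a 0 * cos c - b 0 * sin c)).
Proof.
move=> ha hb; pose l (h : R) := h * s + c.
have hl : is_derive (0 : R) (1 : R) l s.
  have -> : l = s \*: id + cst c by apply/funext => h /=; rewrite /l mulrC.
  by apply: is_derive_eq; rewrite addr0 /GRing.scale/= mulr1.
have hc : is_derive (0 : R) (1 : R) (cos \o l) (- sin c * s).
  have := is_derive_cos (l 0); rewrite {2}/l mul0r add0r => d.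
  exact: is_derive1_comp d hl.
have hs : is_derive (0 : R) (1 : R) (sin \o l) (cos c * s).
  have := is_derive_sin (l 0); rewrite {2}/l mul0r add0r => d.
  exact: is_derive1_comp d hl.
split.
  have h := is_deriveB (is_deriveM ha hc) (is_deriveM hb hs).
  refine (is_derive_eq h _).
  by rewrite /GRing.scale /= /l mul0r add0r; ring.
have h := is_deriveD (is_deriveM ha hs) (is_deriveM hb hc).
refine (is_derive_eq h _).
by rewrite /GRing.scale /= /l mul0r add0r; ring.
Qed.

(** The integral of the [j]-th partial derivative of [f e^(i x.xi)] vanishes, and
    this derivative is [(d_j f + i xi_j f) e^(i x.xi)]. *)
Lemma cintegral_by_parts f (j : 'I_n) t xi K :
  smooth f -> (forall x, Normc.normc (f (t, x)) <= K * weight x) ->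
  (forall x, Normc.normc (cderive (dir_x j) f (t, x)) <= K * weight x) ->
  wave_integral (cderive (dir_x j) f) (t, xi) =
  - (0 +i* xi ord0 j) * wave_integral f (t, xi).
Proof.
move=> sf fK dfK.
have sdf : smooth (cderive (dir_x j) f) := smooth_cderive f (inr j) sf.
pose P x := f (t, x) * expi (dotr x xi).
pose Q x := cderive (dir_x j) f (t, x) * expi (dotr x xi).
(* The derivative of [P] along the [j]-th coordinate. *)
pose G x := 1 * Q x + (0 +i* xi ord0 j) * P x.
suff GI0 : cintegral (leb R n) setT G = 0.
  move: GI0; rewrite /G cintegral_linear//; last 2 first.
  - exact: cintegrable_wave (smooth_cmeasurable _ sdf) dfK.
  - exact: cintegrable_wave (smooth_cmeasurable _ sf) fK.
  by rewrite mul1r => /eqP; rewrite addr_eq0 mulNr => /eqP.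
have line x h : h *: dir_x j + (t, x) = (t, h *: delta_mx ord0 j + x) :> E.
  by congr pair => /=; rewrite scaler0 add0r.
have cline x : continuous (fun h : R => (t, h *: delta_mx ord0 j + x) : E).
  move=> h.
  have c2 : (h' *: delta_mx ord0 j + x) @[h' --> h] --> h *: delta_mx ord0 j + x.
    by apply: cvgD; [exact: scalel_continuous|exact: cvg_cst].
  exact: (cvg_pair (cvg_cst t : t @[_ --> h] --> t) c2).
have csec (g : E -> R[i]) x : smooth g ->
    ccontinuous (fun h : R => g (t, h *: delta_mx ord0 j + x)).
  move=> /smooth_ccontinuous [g1 g2]; split=> h.
    exact: (cvg_comp _ _ (cline x h) (g1 _)).
  exact: (cvg_comp _ _ (cline x h) (g2 _)).
have cexp x : ccontinuous (fun h : R => expi (dotr (h *: delta_mx ord0 j + x) xi)).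
  have cl : continuous (fun h : R => dotr (h *: delta_mx ord0 j + x) xi).
    under eq_fun do rewrite dotr_line.
    by move=> h; apply: cvgD; [apply: cvgMl; exact: cvg_id|exact: cvg_cst].
  split=> h /=; apply: (cvg_comp _ _ (cl h)).
    exact: continuous_cos.
  exact: continuous_sin.
have cG x : ccontinuous (fun h : R => G (h *: delta_mx ord0 j + x)).
  by apply: ccontinuousD; (apply: ccontinuousM; first exact: ccontinuous_cst);
    apply: ccontinuousM => //; exact: csec.
have mG : cmeasurable G.
  apply: cmeasurableD; apply: cmeasurableM; try exact: cmeasurable_cst.
    exact: cmeasurable_wave_section (smooth_cmeasurable _ sdf).
  exact: cmeasurable_wave_section (smooth_cmeasurable _ sf).
have K0 : 0 <= K.
  have := le_trans (normc_ge0 _) (fK 0).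
  by rewrite pmulr_lge0// weight_gt0.
pose K' := K + `|xi ord0 j| * K.
have bP x : Normc.normc (P x) <= K' * weight x.
  rewrite Normc.normcM normc_expi mulr1 (le_trans (fK x))// ler_wpM2r ?(ltW (weight_gt0 _ _))//.
  by rewrite lerDl mulr_ge0.
have bG x : Normc.normc (G x) <= K' * weight x.
  rewrite (le_trans (le_normcD _ _))// mul1r !Normc.normcM !normc_expi !mulr1.
  rewrite mulrDl lerD// -[leRHS]mulrA ler_pM ?normc_ge0//.
  by rewrite /= expr0n add0r sqrtr_sqr.
have dP x :
    is_derive x (delta_mx ord0 j) (fun x => complex.Re (P x)) (complex.Re (G x)) /\
    is_derive x (delta_mx ord0 j) (fun x => complex.Im (P x)) (complex.Im (G x)).
  have [/derivableP fr /derivableP fi] := smooth_cderivable f (inr j) sf (t, x).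
  have [dre dim] := is_derive_wave _ _ _ _ (dotr x xi) (xi ord0 j)
    ((is_derive_alongP _ _ _ _).1 fr) ((is_derive_alongP _ _ _ _).1 fi).
  split; apply/is_derive_alongP.
    rewrite (_ : (fun h => _) = (fun h => complex.Re (f (h *: dir (inr j) + (t, x))) *
        cos (h * xi ord0 j + dotr x xi) - complex.Im (f (h *: dir (inr j) + (t, x))) *
        sin (h * xi ord0 j + dotr x xi))); last first.
      by apply/funext => h; rewrite /P ReM dotr_line line.
    apply: (is_derive_eq dre).
    by rewrite /G /Q /P ReD !ReM !ImM /= scale0r add0r; ring.
  rewrite (_ : (fun h => _) = (fun h => complex.Re (f (h *: dir (inr j) + (t, x))) *
      sin (h * xi ord0 j + dotr x xi) + complex.Im (f (h *: dir (inr j) + (t, x))) *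
      cos (h * xi ord0 j + dotr x xi))); last first.
    by apply/funext => h; rewrite /P ImM dotr_line line.
  apply: (is_derive_eq dim).
  by rewrite /G /Q /P ImD !ImM !ReM /= scale0r add0r; ring.
rewrite /cintegral /Rintegral.
rewrite (integral_partial0 _ j _ _ K' (fun x => (dP x).1)) => [|x||x|x].
- rewrite (integral_partial0 _ j _ _ K' (fun x => (dP x).2)) => [//|x||x|x].
  + by have [] := cG x.
  + by case: mG.
  + by rewrite (le_trans (le_Im_normc _)).
  + by rewrite (le_trans (le_Im_normc _)).
- by have [] := cG x.
- by case: mG.
- by rewrite (le_trans (le_Re_normc _)).
- by rewrite (le_trans (le_Re_normc _)).
Qed.

Lemma integral_mul_weight K :
  \int[leb R n]_(x in setT) (K * weight x) = K * \int[leb R n]_(x in setT) weight x.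
Proof.
rewrite RintegralZl//; have := @integrable_weight R n 1.
by under [X in _.-integrable _ (EFin \o X)]eq_fun do rewrite mul1r.
Qed.

(** Integrating by parts [k] times bounds [|xi_j|^k] times the Fourier integral by
    the integral of a [k]-th derivative, hence by [C^k k!^mu]; decay follows as it
    does for the function itself. *)
Lemma wave_integral_decay sigma mu C : 0 < mu -> 0 < C ->
  exists2 L : R, 0 <= L & forall f r, smooth f -> 0 <= r ->
    (GS_norm sigma mu C f <= r%:E)%E -> forall t xi,
    Normc.normc (wave_integral f (t, xi)) <=
    L * r * expR (- (decay_rate n mu C * enorm xi `^ mu^-1)).
Proof.
move=> mu0 C0.
have [Kw Kw0 expw] := exp_le_weight n mu (decay_rate n mu C) mu0
  (decay_rate_gt0 n mu C mu0 C0).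
pose W := \int[leb R n]_(x in setT) weight x.
have W0 : 0 <= W by apply: Rintegral_ge0 => x _; rewrite ltW// weight_gt0.
exists (2 `^ mu * (2 * 2 `^ mu * Kw * W)).
  by rewrite !mulr_ge0 ?powR_ge0// ltW.
move=> f r sf r0 fr t xi.
have B k : 0 <= 2 `^ mu * (C ^+ k * k`!%:R `^ mu * r).
  by rewrite !mulr_ge0 ?powR_ge0 ?exprn_ge0// ltW.
have f0 x : Normc.normc (f (t, x)) <= 2 `^ mu * r * Kw * weight x.
  rewrite (le_trans (GS_decay _ _ _ _ _ mu0 C0 fr t x))// -[leRHS]mulrA.
  by rewrite ler_wpM2l ?mulr_ge0 ?powR_ge0.
have fk j k x : Normc.normc (iter k (cderive (dir_x j)) f (t, x)) <=
    2 `^ mu * (C ^+ k * k`!%:R `^ mu * r) * Kw * weight x.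
  rewrite (le_trans (GS_cderive_decay _ _ _ _ _ mu0 C0 fr j k t x))// -[leRHS]mulrA.
  by rewrite ler_wpM2l.
have sfk j k : smooth (iter k (cderive (dir_x j)) f).
  exact: (smooth_iter_cderive f (inr j) k sf).
have bound (g : E -> R[i]) K : smooth g ->
    (forall x, Normc.normc (g (t, x)) <= K * weight x) ->
    Normc.normc (wave_integral g (t, xi)) <= 2 * (K * W).
  move=> sg gK; rewrite -integral_mul_weight; apply: normc_cintegral_le => //.
  - exact: cmeasurable_wave_section (smooth_cmeasurable _ sg).
  - by move=> x _; rewrite Normc.normcM normc_expi mulr1.
  - exact: integrable_weight.
have powk j k : `|xi ord0 j| ^+ k * Normc.normc (wave_integral f (t, xi)) =
    Normc.normc (wave_integral (iter k (cderive (dir_x j)) f) (t, xi)).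
  elim: k => [|k IH]; first by rewrite expr0 mul1r.
  pose K1 := 2 `^ mu * (C ^+ k * k`!%:R `^ mu * r) * Kw.
  pose K2 := 2 `^ mu * (C ^+ k.+1 * k.+1`!%:R `^ mu * r) * Kw.
  rewrite iterS (cintegral_by_parts _ _ _ _ (Num.max K1 K2))//.
  - rewrite Normc.normcM normcN -IH exprS -mulrA; congr (_ * _).
    by rewrite /= expr0n add0r sqrtr_sqr.
  - move=> x; rewrite (le_trans (fk j k x))// ler_wpM2r ?(ltW (weight_gt0 _ _))//.
    by rewrite le_max lexx.
  - move=> x; rewrite (le_trans (fk j k.+1 x))// ler_wpM2r ?(ltW (weight_gt0 _ _))//.
    by rewrite le_max lexx orbT.
rewrite -[_ * _ * r]mulrA; apply: exp_decay => //; first exact: normc_ge0.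
  by rewrite (le_trans (bound _ _ sf f0))// le_eqVlt; apply/orP; left; apply/eqP; ring.
move=> j k; rewrite powk (le_trans (bound _ _ (sfk j k) (fk j k)))// le_eqVlt.
by apply/orP; left; apply/eqP; ring.
Qed.

Lemma cintegrable_wave_GS sigma mu f t xi : 0 < mu -> GS m n sigma mu f ->
  cintegrable (leb R n) setT (fun x => f (t, x) * expi (dotr x xi)).
Proof.
move=> mu0 [C /= C0 [sf _ /lty_le_real [r r0 fr]]].
have [Kw Kw0 expw] := exp_le_weight n mu (decay_rate n mu C) mu0
  (decay_rate_gt0 n mu C mu0 C0).
apply: (cintegrable_wave _ _ _ (2 `^ mu * r * Kw)).
  exact: smooth_cmeasurable.
move=> x; rewrite (le_trans (GS_decay _ _ _ _ _ mu0 C0 fr t x))// -[leRHS]mulrA.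
by rewrite ler_wpM2l ?mulr_ge0 ?powR_ge0.
Qed.

Lemma wave_integral_linear sigma mu f g (a b : R[i]) : 0 < mu ->
  GS m n sigma mu f -> GS m n sigma mu g ->
  wave_integral (fun p => a * f p + b * g p) =
  (fun p => a * wave_integral f p + b * wave_integral g p).
Proof.
move=> mu0 Gf Gg; apply/funext => -[t xi].
rewrite /wave_integral /= -cintegral_linear//; last 2 first.
- exact: cintegrable_wave_GS Gf.
- exact: cintegrable_wave_GS Gg.
by apply: eq_cintegral => x _; rewrite mulrDl !mulrA.
Qed.

End fourier_decay.

(** * The functional defined by a subexponential function *)

Section functional.
Context {R : realType} {m n : nat}.
Local Notation E := ('rV[R]_m * 'rV[R]_n)%type.
Implicit Types (h f g : E -> R[i]).

Lemma measurable_torus_cell : measurable (torus_cell R m).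
Proof.
rewrite (_ : torus_cell R m =
    \bigcap_(i in [set: 'I_m]) (@rV_coord R m i @^-1` `[0, 2 * pi[)).
  apply: fin_bigcap_measurable => // i _.
  by rewrite -[X in measurable X]setTI; apply: measurable_rV_coord.
apply/seteqP; split => x /= H i => [_|]; have := H i; rewrite /= in_itv/=.
  by [].
exact.
Qed.

Lemma leb_torus_cell_lty : (leb R m (torus_cell R m) < +oo)%E.
Proof.
(* The boxes measured by [leb_box] are open on the left, hence the bound -1. *)
pose A : set 'rV[R]_m := [set x | forall i, -1 < x ord0 i <= 2 * pi].
have mA : measurable A.
  rewrite (_ : A = \bigcap_(i in [set: 'I_m]) (@rV_coord R m i @^-1` `]-1, 2 * pi])).
    apply: fin_bigcap_measurable => // i _.
    by rewrite -[X in measurable X]setTI; apply: measurable_rV_coord.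
  apply/seteqP; split => x /= H i => [_|]; have := H i; rewrite /= in_itv/=.
    by [].
  exact.
apply: (@le_lt_trans _ _ (leb R m A)).
  apply: le_measure; rewrite ?inE//; first exact: measurable_torus_cell.
  by move=> x H i; have /andP[x0 /ltW ->] := H i; rewrite andbT (lt_le_trans _ x0).
rewrite (leb_box (a := fun=> -1) (b := fun=> 2 * pi)) ?ltry// => i.
by rewrite (@le_trans _ _ 0)// mulr_ge0// pi_ge0.
Qed.

Lemma integrable_torus_cell_cst (K : R) :
  (leb R m).-integrable (torus_cell R m) (EFin \o cst K).
Proof.
apply: (measurable_bounded_integrable measurable_torus_cell leb_torus_cell_lty).
  exact: measurable_cst.
by exists `|K|; split => // M KM x _; exact: ltW.
Qed.

(** Modifying [u] on a Borel null set that contains all exceptional points keeps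
    the pointwise bound. *)
Lemma borel_representative (u : E -> R[i]) : lebesgue_measurable u ->
  exists v : E -> R[i], [/\ cmeasurable v,
    forall p, Normc.normc (v p) <= Normc.normc (u p) &
    {ae leb R m, forall t, {ae leb R n, forall xi, u (t, xi) = v (t, xi)}}].
Proof.
move=> [v0 [v1 v2 [N [mN N0 uvN]]]].
have uv p : ~ N p -> u p = v0 p by move=> Np; apply: contrapT => /uvN.
pose v p := if p \in N then 0 else v0 p.
exists v; split.
- split.
    rewrite (_ : (fun p => _) = (fun p => complex.Re (v0 p)) \_ (~` N)).
      by apply/(measurable_restrictT _ (measurableC mN)); exact: measurable_funTS.
    by apply/funext => p; rewrite patchE /v in_setC; case: (p \in N).
  rewrite (_ : (fun p => _) = (fun p => complex.Im (v0 p)) \_ (~` N)).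
    by apply/(measurable_restrictT _ (measurableC mN)); exact: measurable_funTS.
  by apply/funext => p; rewrite patchE /v in_setC; case: (p \in N).
- move=> p; rewrite /v; case: ifPn => [_|]; first by rewrite Normc.normc0 normc_ge0.
  by move=> /negP; rewrite inE => /uv ->.
have : ae_eq (leb R m) setT (leb R n \o xsection N) (cst 0).
  apply/ae_eq_integral_abs => //; first exact: measurable_fun_xsection.
  by rewrite -[RHS]N0; apply: eq_integral => t _; rewrite gee0_abs.
apply: filterS => t /(_ I) Nt0.
exists (xsection N t); split; first exact: measurable_xsection.
  exact: Nt0.
move=> xi /=; rewrite -/(~ _) => uvt; rewrite /xsection /=.
apply: contrapT => Nxi; apply: uvt; rewrite /v ifN; last by apply/negP.
by apply: uv; move: Nxi; rewrite inE.
Qed.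

Variables (u : E -> R[i]) (u_meas : lebesgue_measurable u).

Let W := \int[leb R n]_(x in setT) weight x.

Let W0 : 0 <= W.
Proof. by apply: Rintegral_ge0 => x _; rewrite ltW// weight_gt0. Qed.

Let V0 : 0 <= fine (leb R m (torus_cell R m)).
Proof. by rewrite fine_ge0// measure_ge0. Qed.

(** The functions on which integration against [u] is linear and controlled by the
    constant [K]. *)
Definition dominated h := cmeasurable h /\
  exists K : R, forall t xi, Normc.normc (u (t, xi) * h (t, xi)) <= K * weight xi.

Lemma cmeasurable_pair2 h t : cmeasurable h -> cmeasurable (fun xi => h (t, xi)).
Proof. by move=> mh; apply: cmeasurable_comp mh; exact: pair1_measurable. Qed.

(** Almost every section of [u] agrees almost everywhere with that of [v], so that
    neither of the two iterated integrals sees the difference. *)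
Lemma functional_of_representative (v : E -> R[i]) h :
  {ae leb R m, forall t, {ae leb R n, forall xi, u (t, xi) = v (t, xi)}} ->
  functional_of u h = functional_of v h.
Proof.
move=> uv; apply: ae_eq_cintegral; apply: filterS uv => t uvt _.
by apply: ae_eq_cintegral; apply: filterS uvt => xi ->.
Qed.

(** Fubini's theorem makes the inner integral measurable for a Borel
    representative [v] of [u]; the bound is inherited from [u]. *)
Lemma dominated_inner (v : E -> R[i]) h K : cmeasurable v ->
  (forall p, Normc.normc (v p) <= Normc.normc (u p)) -> cmeasurable h ->
  (forall t xi, Normc.normc (u (t, xi) * h (t, xi)) <= K * weight xi) ->
  [/\ forall t, cintegrable (leb R n) setT (fun xi => v (t, xi) * h (t, xi)),
      cmeasurable (fun t => cintegral (leb R n) setT (fun xi => v (t, xi) * h (t, xi))) &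
      forall t, Normc.normc
        (cintegral (leb R n) setT (fun xi => v (t, xi) * h (t, xi))) <= 2 * (K * W)].
Proof.
move=> mv vu mh uhK.
have mvh := cmeasurableM v h mv mh.
have vhK t xi : Normc.normc (v (t, xi) * h (t, xi)) <= K * weight xi.
  rewrite (le_trans _ (uhK t xi))// !Normc.normcM ler_wpM2r ?normc_ge0//.
split.
- move=> t; apply: (cintegrable_le _ _ _ (fun x => K * weight x)) => //.
    exact: (cmeasurable_pair2 _ t mvh).
  exact: integrable_weight.
- exact: (cmeasurable_cintegral (leb R n) _ mvh).
- move=> t; rewrite -integral_mul_weight; apply: normc_cintegral_le => //.
    exact: (cmeasurable_pair2 _ t mvh).
  exact: integrable_weight.
Qed.

Lemma functional_of_bound h K : cmeasurable h ->
  (forall t xi, Normc.normc (u (t, xi) * h (t, xi)) <= K * weight xi) ->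
  Normc.normc (functional_of u h) <= 4 * W * fine (leb R m (torus_cell R m)) * K.
Proof.
move=> mh uhK; have [v [mv vu uv]] := borel_representative u u_meas.
rewrite (functional_of_representative v)//.
have [i1 m1 b1] := dominated_inner _ _ _ mv vu mh uhK.
rewrite (le_trans (normc_cintegral_le _ _ _ _ measurable_torus_cell m1
  (fun t _ => b1 t) (integrable_torus_cell_cst _)))//.
rewrite Rintegral_cst; last exact: measurable_torus_cell.
by rewrite le_eqVlt; apply/orP; left; apply/eqP; ring.
Qed.

Lemma functional_of_linear h1 h2 (a b : R[i]) : dominated h1 -> dominated h2 ->
  functional_of u (fun p => a * h1 p + b * h2 p) =
  a * functional_of u h1 + b * functional_of u h2.
Proof.
move=> [mh1 [K1 hK1]] [mh2 [K2 hK2]].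
have [v [mv vu uv]] := borel_representative u u_meas.
rewrite !(functional_of_representative v)//.
have [i1 m1 b1] := dominated_inner _ _ _ mv vu mh1 hK1.
have [i2 m2 b2] := dominated_inner _ _ _ mv vu mh2 hK2.
have mcell := measurable_torus_cell.
rewrite /functional_of -cintegral_linear//; last 2 first.
- exact: (cintegrable_le _ _ _ _ mcell m1 (fun t _ => b1 t)
    (integrable_torus_cell_cst _)).
- exact: (cintegrable_le _ _ _ _ mcell m2 (fun t _ => b2 t)
    (integrable_torus_cell_cst _)).
apply: eq_cintegral => t _; rewrite -cintegral_linear//.
by apply: eq_cintegral => xi _; rewrite mulrDr (mulrCA a) (mulrCA b).
Qed.

Variable mu : R.
Hypothesis mu0 : 0 < mu.
Hypothesis u_bound : forall eps : R, 0 < eps -> exists2 Ceps : R, 0 < Ceps &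
  forall t xi, Normc.normc (u (t, xi)) <= Ceps * expR (eps * enorm xi `^ mu^-1).

(** Half of the decay of [h] absorbs the subexponential growth of [u], the other
    half is dominated by the integrable weight. *)
Lemma decay_dominated (b : R) : 0 < b ->
  exists2 A : R, 0 <= A & forall h K, 0 <= K ->
    (forall t xi, Normc.normc (h (t, xi)) <= K * expR (- (b * enorm xi `^ mu^-1))) ->
    forall t xi, Normc.normc (u (t, xi) * h (t, xi)) <= A * K * weight xi.
Proof.
move=> b0; have b20 : 0 < b / 2 by rewrite divr_gt0.
have [Ce Ce0 uC] := u_bound (b / 2) b20.
have [Kw Kw0 expw] := exp_le_weight n mu (b / 2) mu0 b20.
exists (Ce * Kw); first by rewrite mulr_ge0// ltW.
move=> h K K0 hK t xi; rewrite Normc.normcM.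
rewrite (le_trans (ler_pM (normc_ge0 _) (normc_ge0 _) (uC t xi) (hK t xi)))//.
rewrite mulrACA -expRD (_ : _ + _ = - (b / 2 * enorm xi `^ mu^-1)); last by field.
rewrite (_ : Ce * Kw * K * weight xi = Ce * K * (Kw * weight xi)); last by ring.
by rewrite ler_wpM2l// mulr_ge0// ltW.
Qed.

Let c : R[i] := ((2 * pi) ^- n)%:C.

(** The continuity estimate for both functionals: elements of the step [C] and
    their Fourier integrals decay at one common rate, linearly in the norm. *)
Lemma GS_steps_dominated sigma C : 0 < C ->
  exists2 A : R, 0 <= A & forall f r, GS_C sigma mu C f ->
    0 <= r -> (GS_norm sigma mu C f <= r%:E)%E -> forall t xi,
    Normc.normc (u (t, xi) * f (t, xi)) <= A * r * weight xi /\
    Normc.normc (u (t, xi) * wave_integral f (t, xi)) <= A * r * weight xi.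
Proof.
move=> C0; have [A A0 HA] := decay_dominated _ (decay_rate_gt0 n mu C mu0 C0).
have [L L0 HL] := @wave_integral_decay R m n sigma mu C mu0 C0.
have p0 : 0 <= 2 `^ mu :> R by exact: powR_ge0.
exists (A * (2 `^ mu + L)); first by rewrite mulr_ge0// addr_ge0.
move=> f r [sf _ _] r0 fr t xi; split.
  have fD := GS_decay _ _ _ _ _ mu0 C0 fr.
  rewrite (le_trans (HA f (2 `^ mu * r) _ fD t xi)) ?mulr_ge0//.
  rewrite ler_wpM2r ?(ltW (weight_gt0 _ _))// mulrA ler_wpM2r//.
  by rewrite ler_wpM2l// lerDl.
rewrite (le_trans (HA _ (L * r) _ (HL f r sf r0 fr) t xi)) ?mulr_ge0//.
rewrite ler_wpM2r ?(ltW (weight_gt0 _ _))// mulrA ler_wpM2r//.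
by rewrite ler_wpM2l// lerDr.
Qed.

Lemma GS_dominated sigma f : GS m n sigma mu f ->
  dominated f /\ dominated (wave_integral f).
Proof.
move=> [C /= C0 Cf]; have [A A0 HA] := GS_steps_dominated sigma C C0.
have [sf _ /lty_le_real [r r0 fr]] := Cf.
have mf := smooth_cmeasurable f sf.
by split; split; [|exists (A * r) => t xi; case: (HA f r Cf r0 fr t xi)
  |exact: cmeasurable_wave_integral
  |exists (A * r) => t xi; case: (HA f r Cf r0 fr t xi)].
Qed.

Lemma GS_norm_ge0 sigma C f r : 0 < C -> (GS_norm sigma mu C f <= r%:E)%E -> 0 <= r.
Proof.
move=> C0 /(GS_norm_leP _ _ _ _ _ C0).
move=> /(_ (fun=> 0%N) (fun=> 0%N) (fun=> 0%N) (0, 0)).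
by rewrite !mlength0 !mfact0 !mulr1 !powR1 expr0 !mul1r; apply: le_trans (normc_ge0 _).
Qed.

Lemma functional_of_dual s : GS_dual m n s mu (functional_of u).
Proof.
apply: GS_dual_bounded => [f g a b Gf Gg|C C0].
  exact: functional_of_linear (GS_dominated s f Gf).1 (GS_dominated s g Gg).1.
have [A A0 HA] := GS_steps_dominated s C C0.
exists (4 * W * fine (leb R m (torus_cell R m)) * A).
  by rewrite !mulr_ge0.
move=> f r Cf fr; have r0 := GS_norm_ge0 s C f r C0 fr.
rewrite -[leRHS]mulrA; apply: functional_of_bound.
  by case: Cf => /smooth_cmeasurable.
by move=> t xi; have [] := HA f r Cf r0 fr t xi.
Qed.

Lemma inv_fourier_dualE s f : GS m n s mu f ->
  inv_fourier_dual (functional_of u) f = c * functional_of u (wave_integral f).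
Proof.
move=> Gf; have [_ dh] := GS_dominated s f Gf.
have := functional_of_linear _ _ c 0 dh dh.
rewrite mul0r addr0 => <-; congr functional_of; apply/funext => p.
by rewrite mul0r addr0.
Qed.

Lemma inv_fourier_dual_dual s : GS_dual m n s mu (inv_fourier_dual (functional_of u)).
Proof.
apply: GS_dual_bounded => [f g a b Gf Gg|C C0].
  rewrite !(inv_fourier_dualE s)//; last exact: GS_linear.
  have lin := functional_of_linear _ _ a b
    (GS_dominated s f Gf).2 (GS_dominated s g Gg).2.
  have scale (d X Y : R[i]) : d * (a * X + b * Y) = a * (d * X) + b * (d * Y).
    by ring.
  rewrite (wave_integral_linear s mu f g a b mu0 Gf Gg) lin; exact: scale.
have [A A0 HA] := GS_steps_dominated s C C0.
exists (Normc.normc c * (4 * W * fine (leb R m (torus_cell R m)) * A)).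
  by rewrite !mulr_ge0 ?normc_ge0.
move=> f r Cf fr; have r0 := GS_norm_ge0 s C f r C0 fr.
rewrite (inv_fourier_dualE s); last by exists C.
rewrite Normc.normcM -[leRHS]mulrA ler_wpM2l ?normc_ge0// -[leRHS]mulrA.
apply: functional_of_bound.
  by apply: cmeasurable_wave_integral; case: Cf => /smooth_cmeasurable.
by move=> t xi; have [] := HA f r Cf r0 fr t xi.
Qed.

Lemma fourier_oppE f t xi : fourier f (t, - xi) = wave_integral f (t, xi).
Proof.
apply: eq_cintegral => x _ /=; congr (_ * expi _).
by rewrite /dotr -sumrN; apply: eq_bigr => i _; rewrite mxE mulNr opprK mulrC.
Qed.

Lemma wave_integral_convergent s f : GS m n s mu f ->
  (\int[leb R m]_(t in torus_cell R m) \int[leb R n]_xi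
     (Normc.normc (u (t, xi) * wave_integral f (t, xi)))%:E < +oo)%E.
Proof.
move=> Gf; have [_ [_ [K HK]]] := GS_dominated s f Gf.
have iw : (\int[leb R n]_xi (K * weight xi)%:E < +oo)%E.
  have /integrableP[_] := @integrable_weight R n K.
  apply: le_lt_trans; apply: ge0_le_integral_nomeas => xi _ /=.
    by rewrite lee_fin (le_trans _ (HK 0 xi))// normc_ge0.
  by rewrite lee_fin ler_norm.
apply: (@le_lt_trans _ _ (\int[leb R m]_(t in torus_cell R m)
    \int[leb R n]_xi (K * weight xi)%:E)%E).
  apply: ge0_le_integral_nomeas => t _.
    by apply: integral_ge0 => xi _; rewrite lee_fin normc_ge0.
  apply: ge0_le_integral_nomeas => xi _; first by rewrite lee_fin normc_ge0.
  by rewrite lee_fin.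
rewrite integral_cst; last exact: measurable_torus_cell.
have iw0 : (0 <= \int[leb R n]_xi (K * weight xi)%:E)%E.
  by apply: integral_ge0 => xi _; rewrite lee_fin (le_trans _ (HK 0 xi))// normc_ge0.
rewrite lte_mul_pinfty// ?leb_torus_cell_lty//.
by rewrite ge0_fin_numE.
Qed.

End functional.

Theorem proposition3p12 (R : realType) (m n : nat) (sigma mu : R)
    (u : 'rV[R]_m * 'rV[R]_n -> R[i])
    (hsigma : 1 <= sigma) (hmu : 2^-1 <= mu)
    (u_per : torus_periodic u) (u_meas : lebesgue_measurable u)
    (u_bound : forall eps : R, 0 < eps -> exists2 Ceps : R, 0 < Ceps &
       forall t xi, Normc.normc (u (t, xi)) <=
                      Ceps * expR (eps * enorm xi `^ mu^-1)) :
  (forall s : R, 1 <= s -> GS_dual m n s mu (functional_of u)) /\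
  exists ucheck : ('rV[R]_m * 'rV[R]_n -> R[i]) -> R[i],
    [/\ forall s : R, 1 <= s -> GS_dual m n s mu ucheck,
        forall f, GS m n sigma mu f ->
          [/\ (* the double integral converges absolutely *)
              (\int[leb R m]_(t in torus_cell R m) \int[leb R n]_xi
                 (Normc.normc (u (t, xi) * fourier f (t, - xi)))%:E < +oo)%E,
              ucheck f = ((2 * pi) ^- n)%:C *
                cintegral (leb R m) (torus_cell R m) (fun t =>
                  cintegral (leb R n) setT (fun xi =>
                    cintegral (leb R n) setT (fun x =>
                      u (t, xi) * expi (dotr xi x) * f (t, x)))) &
              ucheck f = ((2 * pi) ^- n)%:C *
                cintegral (leb R m) (torus_cell R m) (fun t =>
                  cintegral (leb R n) setT (fun xi =>
                    u (t, xi) * fourier f (t, - xi)))] &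
        forall s : R, 1 <= s -> forall f, GS m n s mu f ->
          inv_fourier_dual (functional_of u) f = ucheck f].
Proof.
have mu0 : 0 < mu by rewrite (lt_le_trans _ hmu)// invr_gt0.
split=> [s _|]; first exact: functional_of_dual.
exists (inv_fourier_dual (functional_of u)); split.
- by move=> s _; exact: inv_fourier_dual_dual.
- move=> f Gf; have fE t xi := fourier_oppE f t xi.
  rewrite (inv_fourier_dualE _ u_meas mu mu0 u_bound sigma f Gf).
  have cong (c X Y : R[i]) : X = Y -> c * X = c * Y by move=> ->.
  split.
  + have := wave_integral_convergent u mu mu0 u_bound sigma f Gf.
    by apply: le_lt_trans; apply: ge0_le_integral_nomeas => t _;
      [apply: integral_ge0 => xi _|apply: ge0_le_integral_nomeas => xi _];
      rewrite ?fE ?lee_fin ?normc_ge0.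
  + apply: cong; apply: eq_cintegral => t _; apply: eq_cintegral => xi _.
    rewrite /wave_integral -cintegralZl//=; last exact: (cintegrable_wave_GS sigma mu).
    by apply: eq_cintegral => x _; rewrite dotrC mulrAC mulrA.
  + apply: cong; apply: eq_cintegral => t _; apply: eq_cintegral => xi _.
    by rewrite fE.
- by [].
Qed.
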